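(* For every integer $m\ge 0$, the probability distributions $\mathcal L_{T,m}$ and $\mathcal L_{H,m}$ on $\mathbb R$ have unbounded support.
   Context: The empirical spectral distribution (ESD) of an $n\times n$ real symmetric random matrix $A_n$ with eigenvalues $\lambda_1,\dots,\lambda_n$ is $F_{A_n}(x)=\frac1n\sum_{k=1}^n \mathbf 1(\lambda_k\le x)$; the limiting spectral distribution (LSD) of $A_n$ is the almost sure weak limit of $F_{A_n}$ as $n\to\infty$. Let $\{X_k\}_{k\in\mathbb Z}$ be i.i.d. real random variables with mean zero and variance one, and for an integer $m\ge 0$ put $Y^{(m)}_j=\sum_{r=-m}^{m}X_{j+r}$, $j\in\mathbb Z$. Let $T_{n,m}$ be the $n\times n$ symmetric Toeplitz matrix with $(i,j)$-th entry $Y^{(m)}_{|i-j|}/\sqrt n$, and let $H_{n,m}$ be the $n\times n$ Hankel matrix with $(i,j)$-th entry $Y^{(m)}_{n+1-(i+j)}/\sqrt n$. The LSDs of $T_{n,m}$ and $H_{n,m}$ exist almost surely and are non-random symmetric probability distributions (not depending on the law of $X_0$ subject to mean zero and variance one); they are denoted $\mathcal L_{T,m}$ and $\mathcal L_{H,m}$, respectively. *)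

(* Defs.v *)
From HB Require Import structures.
From mathcomp Require Import all_boot all_order all_algebra.
From mathcomp Require Import polyrcf.
From mathcomp Require Import all_classical all_reals all_analysis.

Set Implicit Arguments.
Unset Strict Implicit.
Unset Printing Implicit Defensive.

Import Order.TTheory GRing.Theory Num.Theory.
Import numFieldNormedType.Exports.

Local Open Scope classical_set_scope.
Local Open Scope ring_scope.

(* Real eigenvalues, repeated according to algebraic multiplicity.  A real
   symmetric matrix of order n has exactly n of them. *)
Definition eigenvalues (R : realType) (n : nat) (A : 'M[R]_n) : seq R :=
  flatten [seq nseq (mup z (char_poly A)) z | z <- rootsR (char_poly A)].

(* At n = 0 this is 0 / 0 = 0, which is irrelevant to the limit n -> oo. *)
Definition esd (R : realType) (n : nat) (A : 'M[R]_n) (x : R) : R :=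
  (count (fun l => l <= x) (eigenvalues A))%:R / n%:R.

Definition dist_fun (R : realType) (L : probability R R) (x : R) : R :=
  fine (L `]-oo, x]%classic).

Definition weak_cvg (R : realType) (F : nat -> R -> R) (L : probability R R) :
    Prop :=
  forall x : R, {for x, continuous (dist_fun L)} ->
    F n x @[n --> \oo] --> dist_fun L x.

Definition is_lsd (R : realType) (d : measure_display) (T : measurableType d)
    (P : probability T R) (A : forall n : nat, T -> 'M[R]_n)
    (L : probability R R) : Prop :=
  {ae P, forall w, weak_cvg (fun n => esd (A n w)) L}.

Definition msupport (R : realType) (L : probability R R) : set R :=
  [set x | forall U : set R, open U -> U x -> (0 < L U)%E].

Definition unbounded_support (R : realType) (L : probability R R) : Prop :=
  ~ bounded_set (msupport L).

Definition mutually_independent (R : realType) (d : measure_display)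
    (T : measurableType d) (P : probability T R) (I : choiceType)
    (X : I -> {RV P >-> R}) : Prop :=
  forall (s : seq I) (B : I -> set R), uniq s ->
    (forall i, measurable (B i)) ->
    P (\bigcap_(i in [set` s]) (X i @^-1` B i)) =
    (\prod_(i <- s) P (X i @^-1` B i))%E.

Definition identically_distributed (R : realType) (d : measure_display)
    (T : measurableType d) (P : probability T R) (I : choiceType)
    (X : I -> {RV P >-> R}) : Prop :=
  forall (i j : I) (B : set R), measurable B ->
    distribution P (X i) B = distribution P (X j) B.

(* The summation index r of the window -m <= r <= m is shifted by m. *)
Definition window_sum (R : realType) (T : Type) (X : int -> T -> R) (m : nat)
    (j : int) (w : T) : R :=
  \sum_(r < m.*2.+1) X (j + (r%:Z - m%:Z)) w.

Definition toeplitz (R : realType) (T : Type) (X : int -> T -> R) (m n : nat)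
    (w : T) : 'M[R]_n :=
  \matrix_(i < n, j < n)
    (window_sum X m `|i%:Z - j%:Z| w / Num.sqrt n%:R).

(* Rows and columns are numbered from 0, whence the two successors: the
   1-based entry (i, j) is Y_(n + 1 - (i + j)). *)
Definition hankel (R : realType) (T : Type) (X : int -> T -> R) (m n : nat)
    (w : T) : 'M[R]_n :=
  \matrix_(i < n, j < n)
    (window_sum X m (n.+1%:Z - (i.+1%:Z + j.+1%:Z)) w / Num.sqrt n%:R).

(* Main.v *)
(* Suppose that the limiting law is supported in [-M, M].  Test the matrix A_n
   on Fourier modes: for unit vectors u_k, v_k with entries of modulus n^(-1/2)
   and phases such that conj (u_k)_p (v_k)_q = z_k^(h(p,q)) / n, where z_k is an
   n-th root of unity and A_n(p,q) depends on h(p,q) only, the numbers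
   D_k = Re <u_k, A_n v_k> satisfy
     sum_k (|D_k| - M)_+ <= sum_lambda (|lambda| - M)_+
   because the spectral theorem bounds |D_k| by an average of the |lambda| with
   doubly stochastic weights.  The right-hand side is o(n): only o(n)
   eigenvalues exceed M in modulus, and tr A_n^2 = O(n) in mean.

   On the other hand D_k is a linear form sum_i a_i(k) X_i with small
   coefficients and, on average over k, a variance bounded below.  After
   replacing X_i by a centred finite-valued function of X_i, at a cost governed
   by the Frobenius norm alone, independence gives
     exp (c t^2) <= E exp (t D_k) on average, and E exp (2 t D_k) <= exp (C t^2),
   and for t large compared with M this forces the average of E (D_k - M)_+ to
   stay away from 0, a contradiction. *)

Require Import Defs.
From HB Require Import structures.
From mathcomp Require Import finmap.
From mathcomp Require Import all_boot all_order all_algebra.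
From mathcomp Require Import cyclic separable cyclotomic.
From mathcomp Require Import spectral sesquilinear polyrcf complex.
From mathcomp Require Import ring lra zify.
From mathcomp Require Import all_classical all_reals all_analysis.
From mathcomp Require Import measurable_realfun.

Set Implicit Arguments.
Unset Strict Implicit.
Unset Printing Implicit Defensive.

Import Order.TTheory GRing.Theory Num.Theory.
Import numFieldNormedType.Exports.

Local Open Scope classical_set_scope.
Local Open Scope ring_scope.

(** * Compressions of a symmetric matrix *)

Lemma mul_unitarymx_trC (C : numClosedFieldType) (n : nat) (U W : 'M[C]_n) :
  U \is unitarymx -> W \is unitarymx ->
  U *m map_mx Num.conj W^T \is unitarymx.
Proof. by move=> uU uW; rewrite mul_unitarymx ?trmxC_unitary. Qed.

Lemma trC_mul_unitarymx (C : numClosedFieldType) (n : nat) (U : 'M[C]_n) :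
  U \is unitarymx -> map_mx Num.conj U^T *m U = 1%:M.
Proof. by move=> uU; rewrite -invmx_unitary // mulVmx ?unitarymx_unit. Qed.

Section Pinching.
Variable R : rcfType.
Local Notation C := R[i].
Local Notation toC := (real_complex R).
Local Notation normc := (@Normc.normc R).
Local Open Scope sesquilinear_scope.

Lemma Re_sum (I : Type) (r : seq I) (P : pred I) (F : I -> C) :
  complex.Re (\sum_(i <- r | P i) F i) = \sum_(i <- r | P i) complex.Re (F i).
Proof.
by elim/big_rec2: _ => // i x y _ <-; case: (F i) => ? ?; case: y.
Qed.

Lemma Re_mul_real (x : R) (y : C) : complex.Re (toC x * y) = x * complex.Re y.
Proof. by case: y => a b /=; rewrite mul0r subr0. Qed.

Lemma normc_ge0 (x : C) : 0 <= normc x.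
Proof. by case: x => a b; exact: sqrtr_ge0. Qed.

Lemma normr_Re_le (x : C) : `|complex.Re x| <= normc x.
Proof.
case: x => a b /=; rewrite -sqrtr_sqr ler_wsqrtr // lerDl; exact: sqr_ge0.
Qed.

Lemma Re_mulJ (x : C) : complex.Re (x * x^*) = normc x ^+ 2.
Proof.
case: x => a b /=; rewrite sqr_sqrtr ?addr_ge0 ?sqr_ge0 //.
by rewrite mulrN opprK -!expr2.
Qed.

Lemma unitary_row_normc (n : nat) (S : 'M[C]_n) (k : 'I_n) :
  S \is unitarymx -> \sum_i normc (S k i) ^+ 2 = 1.
Proof.
move=> /unitarymxP /(congr1 (fun M : 'M[C]_n => complex.Re (M k k))).
rewrite !mxE eqxx /= Re_sum => <-; apply: eq_bigr => i _.
by rewrite !mxE Re_mulJ.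
Qed.

Lemma unitary_col_normc (n : nat) (S : 'M[C]_n) (k : 'I_n) :
  S \is unitarymx -> \sum_i normc (S i k) ^+ 2 = 1.
Proof.
rewrite -trmx_unitary => /(@unitary_row_normc _ _ k) <-.
by apply: eq_bigr => i _; rewrite mxE.
Qed.

(** Over [R[i]] a real symmetric matrix is Hermitian, so the complex spectral theorem applies, and
    the spectrum it returns is real. *)
Lemma symmetric_diagonalization (n : nat) (A : 'M[R]_n) : A^T = A ->
  exists (W : 'M[C]_n) (d : 'rV[R]_n), W \is unitarymx /\
    map_mx toC A = W ^t* *m diag_mx (map_mx toC d) *m W.
Proof.
move=> sA; pose B := map_mx toC A.
have hB : B \is hermsymmx.
  apply: realsym_hermsym.
    by apply/is_hermitianmxP; rewrite expr0 scale1r map_mx_id // /B map_trmx sA.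
  by apply/mxOverP => i j; rewrite mxE; apply/complex_realP; exists (A i j).
have := hermitian_normalmx hB; move=> /orthomx_spectralP.
rewrite invmx_unitary ?spectral_unitarymx // => eB.
exists (spectralmx B), (map_mx (@complex.Re R) (spectral_diag B)).
split; first exact: spectral_unitarymx.
have -> : map_mx toC (map_mx (@complex.Re R) (spectral_diag B)) =
    spectral_diag B; last exact: eB.
apply/rowP => i; rewrite !mxE RRe_real //.
by have /mxOverP := hermitian_spectral_diag_real hB; apply.
Qed.

(** Ties the diagonal [d] of a diagonalization to [eigenvalues], which is read off the
    characteristic polynomial. *)
Lemma char_poly_unitary_diag (n : nat) (A : 'M[R]_n) (W : 'M[C]_n)
    (d : 'rV[R]_n) : W \is unitarymx ->
  map_mx toC A = W ^t* *m diag_mx (map_mx toC d) *m W ->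
  char_poly A = \prod_i ('X - (d 0 i)%:P).
Proof.
move=> uW eA; apply: (@map_poly_inj _ _ toC).
rewrite map_char_poly eA -invmx_unitary //.
have -> : char_poly (invmx W *m diag_mx (map_mx toC d) *m W) =
          char_poly (diag_mx (map_mx toC d)).
  have e : map_mx polyC (invmx W) *m map_mx polyC W = 1%:M.
    by rewrite -map_mxM mulVmx ?unitarymx_unit // map_mx1.
  rewrite /char_poly /char_poly_mx.
  have -> : 'X%:M - map_mx polyC (invmx W *m diag_mx (map_mx toC d) *m W) =
     map_mx polyC (invmx W) *m
     ('X%:M - map_mx polyC (diag_mx (map_mx toC d))) *m map_mx polyC W.
    by rewrite mulmxBr mulmxBl !map_mxM /= scalar_mxC -(mulmxA 'X%:M) e mulmx1.
  by rewrite !det_mulmx mulrAC -det_mulmx e det1 mul1r.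
rewrite char_poly_trig ?diag_mx_is_trig // rmorph_prod.
apply: eq_bigr => i _.
by rewrite rmorphB /= map_polyX map_polyC !mxE eqxx mulr1n.
Qed.

(** On either side, the number of occurrences of [z] is the multiplicity of [z] as a root of [p]. *)
Lemma perm_roots_prod_XsubC (s : seq R) (p := \prod_(y <- s) ('X - y%:P)) :
  perm_eq (flatten [seq nseq (mup z p) z | z <- rootsR p]) s.
Proof.
have p0 : p != 0 by rewrite monic_neq0 // monic_prod_XsubC.
apply/allP => z _ /=; apply/eqP; rewrite count_flatten -map_comp.
rewrite -(mu_prod_XsubC z s) -/p.
have -> : map (count_mem z \o (fun z0 => nseq (mup z0 p) z0)) (rootsR p)
   = [seq if x == z then mup z p else 0%N | x <- rootsR p].
  apply: eq_map => x /=; rewrite count_nseq /=.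
  by case: eqP => [->|_]; rewrite ?mul1n ?mul0n.
have mz : (z \in rootsR p) = root p z.
  by rewrite -(roots_on_rootsR p0 z) in_itv.
rewrite sumnE big_map -big_mkcond /=.
have [rz|nrz] := boolP (root p z).
  rewrite (big_rem z) ?mz //= eqxx big_mkcond big1_seq /= ?addn0 // => x.
  rewrite mem_rem_uniq; last first.
    by apply: sorted_uniq (sorted_roots _ _ _); [exact: lt_trans|exact: ltxx].
  by rewrite !inE => /andP[/negPf ->].
rewrite mupNroot //.
by rewrite big_mkcond big1 // => x _; case: ifP.
Qed.

(* Two orthonormal families are allowed, since a Hankel matrix has to be tested
   on a Fourier mode and its conjugate. *)
Definition pinch (n : nat) (A : 'M[R]_n) (U V : 'M[C]_n) (k : 'I_n) : R :=
  complex.Re ((U *m map_mx toC A *m V ^t*) k k).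

(** In the eigenbasis the entry is the sum of [d_i S_ki T_ik], with [S] and [T] as in the proof, and
    [|S_ki T_ik|] is at most the mean of the two squares. *)
Lemma pinch_le (n : nat) (A : 'M[R]_n) (W U V : 'M[C]_n) (d : 'rV[R]_n)
    (k : 'I_n) :
  map_mx toC A = W ^t* *m diag_mx (map_mx toC d) *m W ->
  `|pinch A U V k| <= \sum_i `|d 0 i| *
     ((normc ((U *m W ^t*) k i) ^+ 2 + normc ((W *m V ^t*) i k) ^+ 2) / 2).
Proof.
move=> eA; rewrite /pinch eA !mulmxA -[_ *m W *m _]mulmxA.
set S := U *m _; set T := W *m _.
rewrite mxE Re_sum; apply: (le_trans (ler_norm_sum _ _ _)).
apply: ler_sum => i _; rewrite mul_mx_diag mxE [_ 0 i]mxE.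
rewrite (mulrC (S k i)) -mulrA Re_mul_real normrM.
apply: ler_wpM2l => //; apply: (le_trans (normr_Re_le _)).
rewrite Normc.normcM ler_pdivlMr // -subr_ge0.
have -> : normc (S k i) ^+ 2 + normc (T i k) ^+ 2 -
    normc (S k i) * normc (T i k) * 2 = (normc (S k i) - normc (T i k)) ^+ 2.
  by rewrite sqrrB mulr_natr; ring.
exact: sqr_ge0.
Qed.

Lemma sum_pinch_le (n : nat) (A : 'M[R]_n) (W U V : 'M[C]_n) (d : 'rV[R]_n)
    (b : R) :
  W \is unitarymx -> U \is unitarymx -> V \is unitarymx ->
  map_mx toC A = W ^t* *m diag_mx (map_mx toC d) *m W ->
  \sum_k Num.max (`|pinch A U V k| - b) 0 <= \sum_i Num.max (`|d 0 i| - b) 0.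
Proof.
move=> uW uU uV eA.
have uS := mul_unitarymx_trC uU uW.
have uT := mul_unitarymx_trC uW uV.
have pl k := pinch_le U V k eA.
move: uS uT pl; move: (U *m _) (W *m V ^t* ) => S T uS uT pl.
have h2 : (1 + 1) / 2 = 1 :> R by rewrite -mulr2n divff // pnatr_eq0.
(* Rows and columns of unitary matrices are unit vectors, so these weights are doubly stochastic;
   the rest is Jensen's inequality for the convex map [x -> (|x| - b)_+]. *)
pose w k i := (normc (S k i) ^+ 2 + normc (T i k) ^+ 2) / 2.
have w0 k i : 0 <= w k i by rewrite divr_ge0 ?addr_ge0 ?sqr_ge0.
have wr k : \sum_i w k i = 1.
  rewrite -mulr_suml big_split /=.
  by rewrite (unitary_row_normc k uS) (unitary_col_normc k uT) h2.
have wc i : \sum_k w k i = 1.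
  rewrite -mulr_suml big_split /=.
  by rewrite (unitary_col_normc i uS) (unitary_row_normc i uT) h2.
have -> : \sum_i Num.max (`|d 0 i| - b) 0 =
    \sum_k \sum_i w k i * Num.max (`|d 0 i| - b) 0.
  by rewrite exchange_big; apply: eq_bigr => i _; rewrite -mulr_suml wc mul1r.
apply: ler_sum => k _; rewrite ge_max; apply/andP; split; last first.
  by apply: sumr_ge0 => i _; rewrite mulr_ge0 // le_max lexx orbT.
rewrite lerBlDr; apply: (le_trans (pl k)).
rewrite [X in _ <= _ + X](_ : b = \sum_i w k i * b); last first.
  by rewrite -mulr_suml wr mul1r.
rewrite -big_split /=; apply: ler_sum => i _.
rewrite -/(w k i) mulrC -mulrDr.
by apply: ler_wpM2l => //; rewrite -lerBlDr le_max lexx.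
Qed.

(** The squared Frobenius norm is the trace of the adjoint of [M] times [M], in which [U]
    cancels. *)
Lemma sum_normc_unitaryl (m n : nat) (M : 'M[C]_(m, n)) (U : 'M[C]_m) :
  U \is unitarymx ->
  \sum_i \sum_j normc ((U *m M) i j) ^+ 2 = \sum_i \sum_j normc (M i j) ^+ 2.
Proof.
have E (N : 'M[C]_(m, n)) :
    \sum_i \sum_j normc (N i j) ^+ 2 = complex.Re (\tr (N ^t* *m N)).
  rewrite exchange_big /= /mxtrace Re_sum; apply: eq_bigr => j _.
  rewrite mxE Re_sum; apply: eq_bigr => i _.
  by rewrite !mxE mulrC Re_mulJ.
move=> uU; rewrite !E trmx_mul map_mxM mulmxA -(mulmxA _ _ U).
by rewrite (trC_mul_unitarymx uU) mulmx1.
Qed.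

Lemma sum_normc_trC (m n : nat) (M : 'M[C]_(m, n)) :
  \sum_i \sum_j normc (M ^t* i j) ^+ 2 = \sum_i \sum_j normc (M i j) ^+ 2.
Proof.
rewrite exchange_big; apply: eq_bigr => i _; apply: eq_bigr => j _.
by rewrite !mxE; case: (M i j) => a b /=; rewrite sqrrN.
Qed.

Lemma sum_normc_unitaryr (n : nat) (M V : 'M[C]_n) :
  V \is unitarymx ->
  \sum_i \sum_j normc ((M *m V ^t*) i j) ^+ 2 = \sum_i \sum_j normc (M i j) ^+ 2.
Proof.
move=> uV; rewrite -(sum_normc_trC (M *m _)) trmx_mul map_mxM trmxCK.
by rewrite sum_normc_unitaryl // sum_normc_trC.
Qed.

Lemma sum_normc_real (n : nat) (A : 'M[R]_n) :
  \sum_i \sum_j normc (map_mx toC A i j) ^+ 2 = \sum_i \sum_j A i j ^+ 2.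
Proof.
apply: eq_bigr => i _; apply: eq_bigr => j _.
by rewrite mxE /= expr0n addr0 sqr_sqrtr ?sqr_ge0.
Qed.

(** The numbers [pinch A U V k] are real parts of diagonal entries of a matrix with the same
    Frobenius norm as [A]. *)
Lemma sum_sqr_pinch_le (n : nat) (A : 'M[R]_n) (U V : 'M[C]_n) :
  U \is unitarymx -> V \is unitarymx ->
  \sum_k pinch A U V k ^+ 2 <= \sum_i \sum_j A i j ^+ 2.
Proof.
move=> uU uV; rewrite -sum_normc_real -(sum_normc_unitaryl _ uU).
rewrite -(sum_normc_unitaryr _ uV); apply: ler_sum => k _.
rewrite (bigD1 k) //= -[leLHS]addr0; apply: lerD; last first.
  by apply: sumr_ge0 => *; exact: sqr_ge0.
rewrite -real_normK ?num_real // lerXn2r ?nnegrE ?normc_ge0 //.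
exact: normr_Re_le.
Qed.

Lemma sum_sqr_diagonal (n : nat) (A : 'M[R]_n) (W : 'M[C]_n) (d : 'rV[R]_n) :
  W \is unitarymx -> map_mx toC A = W ^t* *m diag_mx (map_mx toC d) *m W ->
  \sum_i d 0 i ^+ 2 = \sum_i \sum_j A i j ^+ 2.
Proof.
move=> uW eA; rewrite -sum_normc_real eA.
have uWt : W ^t* \is unitarymx by rewrite trmxC_unitary.
rewrite -{2}[W]trmxCK sum_normc_unitaryr // sum_normc_unitaryl //.
rewrite -map_diag_mx sum_normc_real; apply: eq_bigr => i _.
rewrite (bigD1 i) //= big1 ?addr0 => [|j ji].
  by rewrite mxE eqxx mulr1n.
by rewrite mxE eq_sym (negPf ji) mulr0n expr0n.
Qed.

End Pinching.

(** * Fourier modes *)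

(** In characteristic zero ['X^n - 1] is separable, hence has [n] distinct roots, and [n] distinct
    [n]-th roots of unity include a primitive one. *)
Lemma exists_prim_root (C : numClosedFieldType) (n : nat) : (0 < n)%N ->
  exists z : C, n.-primitive_root z.
Proof.
move=> n_gt0; have [r e] := closed_field_poly_normal ('X^n - 1 : {poly C}).
have {}e : \prod_(y <- r) ('X - y%:P) = 'X^n - 1.
  by rewrite [RHS]e (monicP (monicXnsubC _ n_gt0)) scale1r.
have size_r : size r = n.
  by apply/succn_inj; rewrite -(size_prod_XsubC r id) e size_XnsubC.
have uniq_r : uniq r.
  by rewrite -separable_prod_XsubC e separable_Xn_sub_1 // pnatr_eq0 -lt0n.
have unity_r : all n.-unity_root r.
  by apply/allP => y yr; rewrite /root_of_unity -e root_prod_XsubC.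
have := has_prim_root n_gt0 unity_r uniq_r; rewrite size_r leqnn.
by move=> /(_ isT)/hasP[z _ zP]; exists z.
Qed.

Lemma sum_unity_powers (F : fieldType) (n : nat) (w : F) : w ^+ n = 1 ->
  \sum_(k < n) w ^+ k = if w == 1 then n%:R else 0.
Proof.
move=> w1; case: eqP => [->|/eqP nw].
  by under eq_bigr do rewrite expr1n; rewrite sumr_const card_ord.
by apply/(mulfI (_ : w - 1 != 0)); rewrite ?subr_eq0 // -subrX1 w1 subrr mulr0.
Qed.

Section Fourier.
Variable R : rcfType.
Local Notation C := R[i].
Local Notation toC := (real_complex R).
Local Notation normc := (@Normc.normc R).
Local Open Scope sesquilinear_scope.
Variables (n : nat) (z : C).
Hypothesis zP : n.-primitive_root z.

Let n_gt0 : (0 < n)%N := prim_order_gt0 zP.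

(** [|z| ^ n = 1] with [|z| >= 0] forces [|z| = 1]. *)
Lemma prim_root_mulJ : z * z^* = 1.
Proof.
have nz : normc z = 1.
  apply/eqP; rewrite -(@pexpr_eq1 _ _ n) ?normc_ge0 //.
  have H k : normc z ^+ k = normc (z ^+ k).
    elim: k => [|k IH]; first by rewrite !expr0 Normc.normc1.
    by rewrite !exprS Normc.normcM IH.
  by rewrite H (prim_expr_order zP) Normc.normc1.
case: z nz => a b /= /(congr1 (fun x => x ^+ 2)).
rewrite sqr_sqrtr ?addr_ge0 ?sqr_ge0 // expr1n => E.
by apply/eqP; rewrite eq_complex /= mulrN opprK -!expr2 E mulrN mulrC addNr !eqxx.
Qed.

Lemma conj_prim_root : z^* = z^-1.
Proof.
have z0 : z != 0 by rewrite (prim_root_eq0 zP) -lt0n.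
by apply: (mulfI z0); rewrite prim_root_mulJ divff.
Qed.

(** Discrete Fourier matrix with its columns relabelled by [a]; the relabelling serves to reverse
    their order in the Toeplitz case. *)
Definition fourier (a : 'I_n -> 'I_n) : 'M[C]_n :=
  \matrix_(k, p) (toC (Num.sqrt n%:R)^-1 * z ^+ (k * a p)).

Lemma fourier_unitary (a : 'I_n -> 'I_n) : injective a -> fourier a \is unitarymx.
Proof.
move=> inj_a; apply/unitarymxP/matrixP => k l; rewrite !mxE.
have s0 : (Num.sqrt n%:R : R) != 0 by rewrite sqrtr_eq0 -ltNge ltr0n.
pose w := z ^+ k * (z ^- l).
transitivity (toC (n%:R^-1) * \sum_(p < n) w ^+ p).
  rewrite [in RHS](reindex_inj inj_a) mulr_sumr; apply: eq_bigr => p _.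
  rewrite !mxE rmorphM rmorphXn /=.
  rewrite (_ : Num.conj (toC _) = toC (Num.sqrt n%:R)^-1); last first.
    by apply/eqP; rewrite eq_complex /= oppr0 !eqxx.
  rewrite mulrACA -rmorphM /= -invfM -expr2 sqr_sqrtr ?ler0n //.
  by rewrite conj_prim_root /w exprMn !exprVn -!exprM.
rewrite (@sum_unity_powers _ n w); last first.
  rewrite /w exprMn exprVn -!exprM !(mulnC _ n) !exprM (prim_expr_order zP).
  by rewrite !expr1n invr1 mulr1.
have z0 : z != 0 by rewrite (prim_root_eq0 zP) -lt0n.
have -> : (w == 1) = (k == l).
  rewrite -(inj_eq (mulIf (expf_neq0 l z0))) /w mulfVK ?expf_neq0 // mul1r.
  by rewrite (eq_prim_root_expr zP) !modn_small.
case: eqP => _; last by rewrite mulr0.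
by rewrite -(rmorph_nat toC) -rmorphM /= mulVf ?rmorph1 // pnatr_eq0 -lt0n.
Qed.

Lemma conj_fourier_unitary (b : 'I_n -> 'I_n) :
  injective b -> map_mx Num.conj (fourier b) \is unitarymx.
Proof. by rewrite conjC_unitary; exact: fourier_unitary. Qed.

(** If [z = exp (2 pi i j / n)] with [j] prime to [n], this is [cos (2 pi j k h / n)]. *)
Definition cosk (k : 'I_n) (h : nat) : R := complex.Re (z ^+ (k * h)).

Lemma normc_prim_rootX (k : nat) : normc (z ^+ k) = 1.
Proof.
elim: k => [|k IH]; first by rewrite expr0 Normc.normc1.
rewrite exprS Normc.normcM IH mulr1; apply/eqP; rewrite -sqrp_eq1 ?normc_ge0 //.
by rewrite -Re_mulJ prim_root_mulJ.
Qed.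

Lemma normr_cosk_le1 (k : 'I_n) (h : nat) : `|cosk k h| <= 1.
Proof. by apply: (le_trans (normr_Re_le _)); rewrite normc_prim_rootX. Qed.

Lemma sum_coskM (h h' : nat) :
  \sum_k cosk k h * cosk k h' =
  (complex.Re (\sum_(k < n) (z ^+ (h + h')) ^+ k) +
   complex.Re (\sum_(k < n) (z ^+ h / z ^+ h') ^+ k)) / 2.
Proof.
rewrite !Re_sum -big_split mulr_suml; apply: eq_bigr => k _ /=.
rewrite exprMn exprVn -!exprM mulnDl exprD !(mulnC _ k) -exprVn.
rewrite -conj_prim_root -rmorphXn /cosk.
case: (z ^+ (k * h)) => a b; case: (z ^+ (k * h')) => c d /=.
by field.
Qed.

Lemma sum_unity_powersX (w : C) : w ^+ n = 1 ->
  complex.Re (\sum_(k < n) w ^+ k) = if w == 1 then n%:R else 0.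
Proof.
move=> /sum_unity_powers ->; case: eqP => // _.
by rewrite -(rmorph_nat toC).
Qed.

Let root1 (h : nat) : (z ^+ h) ^+ n = 1.
Proof. by rewrite -exprM mulnC exprM (prim_expr_order zP) expr1n. Qed.

(** By the product-to-sum formula, two geometric sums remain, each equal to 0 or [n]. This sign lets
    terms be dropped in the lower bound for the variance. *)
Lemma sum_coskM_ge0 (h h' : nat) : 0 <= \sum_k cosk k h * cosk k h'.
Proof.
rewrite sum_coskM !sum_unity_powersX ?root1 ?exprMn ?exprVn ?root1 ?invr1 ?mulr1 //.
by rewrite divr_ge0 // addr_ge0 //; case: ifP.
Qed.

Lemma sum_sqr_cosk_ge (h : nat) : n%:R / 2 <= \sum_k cosk k h * cosk k h.
Proof.
rewrite sum_coskM !sum_unity_powersX ?root1 ?exprMn ?exprVn ?root1 ?invr1 ?mulr1 //.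
have z0 : z != 0 by rewrite (prim_root_eq0 zP) -lt0n.
(* For [h = h'] the difference frequency is 0 and already contributes [n]. *)
rewrite divff ?expf_neq0 // eqxx ler_pM2r ?invr_gt0 // lerDr.
by case: ifP.
Qed.

(** Conjugating the second Fourier matrix makes the exponents [a p] and [b q] add up instead of
    being subtracted. *)
Lemma pinch_fourier (A : 'M[R]_n) (a b : 'I_n -> 'I_n) (k : 'I_n) :
  pinch A (fourier a) (map_mx Num.conj (fourier b)) k =
  n%:R^-1 * \sum_p \sum_q A p q * cosk k (a p + b q).
Proof.
rewrite /pinch mxE Re_sum exchange_big mulr_sumr; apply: eq_bigr => q _ /=.
rewrite mxE mulr_suml Re_sum mulr_sumr; apply: eq_bigr => p _.
rewrite /cosk !mxE conjCK mulnDr exprD.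
rewrite (_ : _ * _ * _ = toC (n%:R^-1 * A p q) * (z ^+ (k * a p) * z ^+ (k * b q))).
  by rewrite Re_mul_real mulrA.
rewrite -[n%:R in RHS](@sqr_sqrtr _ n%:R) ?ler0n // expr2 invfM !rmorphM /=.
by ring.
Qed.

End Fourier.

(* The numbers [c k h] stand for [cos (2 pi k h / n)]; [b] is the identity for a
   Hankel matrix and the order reversal for a Toeplitz matrix. *)
Definition compression (R : realType) (n : nat) (c : 'I_n -> nat -> R)
    (b : 'I_n -> 'I_n) (A : 'M[R]_n) (k : 'I_n) : R :=
  n%:R^-1 * \sum_p \sum_q A p q * c k (p + b q)%N.

(** * Excess of the compressions against the spectral distribution *)

Lemma tail_pointwise (R : realType) (K M d : R) : 0 < K -> 0 <= M ->
  Num.max (`|d| - M) 0 <=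
  K * (1 - (d <= M)%R%:R + (d <= - M)%R%:R) + d ^+ 2 / (4 * K).
Proof.
move=> K0 M0.
have q0 : 0 <= d ^+ 2 / (4 * K) by rewrite divr_ge0 ?sqr_ge0 // mulr_ge0 ?ltW.
have bK (x : bool) : 0 <= x%:R :> R by exact: ler0n.
have b1 (x : bool) : x%:R <= 1 :> R by case: x.
rewrite ge_max; apply/andP; split; last first.
  by rewrite addr_ge0 // mulr_ge0 ?(ltW K0) // addr_ge0 // subr_ge0.
have [dM|Md] := leP `|d| M.
  apply: (@le_trans _ _ 0); first by rewrite subr_le0.
  by rewrite addr_ge0 // mulr_ge0 ?(ltW K0) // addr_ge0 // subr_ge0.
(* Used when [|d| > M]: the bracket [1 - (d <= M) + (d <= - M)], which is the indicator of [d]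
   outside []-M, M]], is then 1. *)
have amgm : `|d| <= K + d ^+ 2 / (4 * K).
  rewrite -subr_ge0 -(@real_normK _ d) ?num_real //.
  have -> : K + `|d| ^+ 2 / (4 * K) - `|d| = (2 * K - `|d|) ^+ 2 / (4 * K).
    by field; rewrite gt_eqF.
  by rewrite divr_ge0 ?sqr_ge0 // mulr_ge0 ?ltW.
apply: (@le_trans _ _ (K + d ^+ 2 / (4 * K))).
  by apply: le_trans amgm; rewrite lerBlDr lerDl.
rewrite lerD2r ler_peMr ?(ltW K0) //.
move: Md; rewrite ltr_normr => /orP[Md|Md].
  by rewrite [d <= M]leNgt Md subr0 lerDl.
have -> : d <= - M by rewrite ltW // ltrNr.
by rewrite /= lerDr subr_ge0 b1.
Qed.

Section EsdDiagonal.
Local Open Scope sesquilinear_scope.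

Lemma esd_diagonal (R : realType) (n : nat) (A : 'M[R]_n) (W : 'M[R[i]]_n)
    (d : 'rV[R]_n) (x : R) : (0 < n)%N -> W \is unitarymx ->
  map_mx (real_complex R) A =
    W ^t* *m diag_mx (map_mx (real_complex R) d) *m W ->
  n%:R * esd A x = \sum_i (d 0 i <= x)%R%:R.
Proof.
move=> n0 uW eA; rewrite /esd mulrCA mulfV ?pnatr_eq0 -?lt0n // mulr1.
rewrite /eigenvalues (char_poly_unitary_diag uW eA).
rewrite -(big_map (fun i => d 0 i) predT (fun y => 'X - y%:P)).
have /permP -> := perm_roots_prod_XsubC (map (fun i => d 0 i) (index_enum 'I_n)).
rewrite -sum1_count big_map natr_sum [LHS]big_mkcond.
by apply: eq_bigr => i _; case: ifP.
Qed.

End EsdDiagonal.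

Lemma esd_le1 (R : realType) (n : nat) (A : 'M[R]_n) (x : R) :
  (0 < n)%N -> A^T = A -> esd A x <= 1.
Proof.
move=> n0 sA; have [W [d [uW eA]]] := symmetric_diagonalization sA.
have n0' : 0 < n%:R :> R by rewrite ltr0n.
rewrite -(ler_pM2l n0') (esd_diagonal _ n0 uW eA) mulr1.
have -> : n%:R = \sum_(i < n) 1 :> R by rewrite sumr_const card_ord.
by apply: ler_sum => i _; case: (d 0 i <= x)%R.
Qed.

Lemma le_esd (R : realType) (n : nat) (A : 'M[R]_n) (x y : R) :
  x <= y -> esd A x <= esd A y.
Proof.
move=> xy; rewrite /esd ler_wpM2r ?invr_ge0 ?ler0n // ler_nat.
by apply: sub_count => l /= /le_trans; apply.
Qed.

(** Collects all that is used of the Fourier modes, so that complex numbers do not occur afterwards.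
    The last bound sums [tail_pointwise] over the eigenvalues. *)
Lemma exists_compression (R : realType) (n : nat) : (0 < n)%N ->
  exists c : 'I_n -> nat -> R,
  [/\ forall k h, `|c k h| <= 1,
      forall h h', 0 <= \sum_k c k h * c k h',
      forall h, n%:R / 2 <= \sum_k c k h * c k h &
      forall b : 'I_n -> 'I_n, injective b -> forall A : 'M[R]_n,
        \sum_k compression c b A k ^+ 2 <= \sum_i \sum_j A i j ^+ 2 /\
        (A^T = A -> forall K M : R, 0 < K -> 0 <= M ->
          \sum_k Num.max (`|compression c b A k| - M) 0 <=
          K * (n%:R * (1 - esd A M + esd A (- M))) +
          (\sum_i \sum_j A i j ^+ 2) / (4 * K))].
Proof.
move=> n0; have [z zP] := exists_prim_root R[i] n0.
exists (cosk z); split.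
- exact: normr_cosk_le1 zP.
- exact: sum_coskM_ge0 zP.
- exact: sum_sqr_cosk_ge zP.
move=> b binj A.
have uU := fourier_unitary zP (@inj_id 'I_n).
have uV := conj_fourier_unitary zP binj.
have cE k : compression (cosk z) b A k = _ := esym (pinch_fourier z A id b k).
split.
  under eq_bigr do rewrite cE.
  exact: sum_sqr_pinch_le.
move=> sA K M K0 M0; under eq_bigr do rewrite cE.
have [W [d [uW eA]]] := symmetric_diagonalization sA.
apply: (le_trans (sum_pinch_le M uW uU uV eA)).
rewrite -(sum_sqr_diagonal uW eA) mulr_suml.
rewrite mulrDr mulrBr !(esd_diagonal _ n0 uW eA) mulr1 -[n%:R]mulr_natl.
have -> : n%:R * 1 = \sum_(i < n) 1 :> R by rewrite sumr_const card_ord mulr1.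
rewrite -sumrB -big_split mulr_sumr -big_split /=.
by apply: ler_sum => i _; apply: tail_pointwise.
Qed.

(** * Compressions as linear forms in the noise *)

(** Groups a sum over index triples by the noise variable that they meet; read backwards, it unfolds
    one coefficient into its triples. *)
Lemma sum_fibres (R : nzRingType) (T : finType) (I : eqType) (phi : T -> I)
    (f : T -> R) (y : I -> R) :
  \sum_t f t * y (phi t) =
  \sum_(i <- undup (map phi (enum T))) (\sum_(t | phi t == i) f t) * y i.
Proof.
under [RHS]eq_bigr do rewrite mulr_suml big_mkcond.
rewrite exchange_big; apply: eq_bigr => t _ /=.
rewrite (bigD1_seq (phi t)) ?undup_uniq //= ?eqxx; last first.
  by rewrite mem_undup map_f // mem_enum.
by rewrite big1 ?addr0 // => i; rewrite eq_sym => /negPf ->.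
Qed.

(* Sum over [u] of [N u ^+ 2 >= 2 * t * N u - t ^+ 2], where [N u] is the size of
   the fibre over [u]; this is Cauchy-Schwarz for [t = #|T| / #|K|]. *)
Lemma sum_key_collisions (R : realFieldType) (T K : finType) (key : T -> K) (t : R) :
  2 * t * #|T|%:R - t ^+ 2 * #|K|%:R <=
  \sum_x #|[pred x' | key x' == key x]|%:R.
Proof.
pose N u : R := #|[pred x | key x == u]|%:R.
have sN : \sum_u N u = #|T|%:R.
  rewrite /N -natr_sum; congr _%:R; rewrite -sum1_card (partition_big key predT) //=.
  by apply: eq_bigr => u _; rewrite sum1_card.
have -> : \sum_x #|[pred x' | key x' == key x]|%:R = \sum_u N u ^+ 2.
  rewrite (partition_big key predT) //=; apply: eq_bigr => u _.
  rewrite (eq_bigr (fun=> N u)); last by move=> x /eqP ->.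
  by rewrite sumr_const expr2 mulr_natr.
rewrite -sN -[#|K|]sum1_card natr_sum !mulr_sumr -sumrB; apply: ler_sum => u _.
rewrite -subr_ge0 (_ : _ - _ = (N u - t) ^+ 2) ?sqr_ge0 //; ring.
Qed.

Definition window_matrix (R : realType) (T : Type) (m n : nat)
    (g : 'I_n -> 'I_n -> int) (X : int -> T -> R) (w : T) : 'M[R]_n :=
  \matrix_(i < n, j < n) (window_sum X m (g i j) w / Num.sqrt n%:R).

Section LinearForm.
Variables (R : realType) (m n : nat) (c : 'I_n -> nat -> R) (b : 'I_n -> 'I_n).
Variable G : nat -> int.
Hypothesis n0 : (0 < n)%N.
Hypothesis c1 : forall k h, `|c k h| <= 1.
Hypothesis cc0 : forall h h', 0 <= \sum_k c k h * c k h'.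
Hypothesis cc1 : forall h, n%:R / 2 <= \sum_k c k h * c k h.
Hypothesis G2 : forall p z, (#|[pred q : 'I_n | G (p + b q) == z]| <= 2)%N.

Local Notation tri := ('I_n * 'I_n * 'I_m.*2.+1)%type.
Let h (t : tri) : nat := (t.1.1 + b t.1.2)%N.
Let phi (t : tri) : int := G (h t) + ((t.2 : nat)%:Z - m%:Z).
Let kap : R := n%:R^-1 * (Num.sqrt n%:R)^-1.

Definition coef_support : seq int := undup (map phi (enum {: tri})).
(** A triple is a matrix position with a window shift, and [phi] is the index of the noise variable
    it meets; [coef k i] is the coefficient of this variable in the [k]-th compression. *)
Definition coef (k : 'I_n) (i : int) : R := \sum_(t | phi t == i) kap * c k (h t).

Let kap0 : 0 <= kap. Proof. by rewrite mulr_ge0 ?invr_ge0 ?ler0n ?sqrtr_ge0. Qed.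
Let s0 : (Num.sqrt n%:R : R) != 0.
Proof. by rewrite sqrtr_eq0 -ltNge ltr0n. Qed.
Let kapE : kap ^+ 2 = n%:R ^- 3.
Proof.
by rewrite /kap exprMn !exprVn sqr_sqrtr ?ler0n // -invfM -exprSr.
Qed.

Lemma coef_support_uniq : uniq coef_support. Proof. exact: undup_uniq. Qed.

Lemma compression_linear (T : Type) (X : int -> T -> R) (w : T) (k : 'I_n) :
  compression c b (window_matrix m (fun p q => G (p + b q)) X w) k =
  \sum_(i <- coef_support) coef k i * X i w.
Proof.
rewrite /coef_support /coef -sum_fibres /compression.
rewrite pair_bigA /= mulr_sumr.
rewrite -(pair_bigA _ (fun (pq : 'I_n * 'I_n) (r : 'I_m.*2.+1) =>
  kap * c k (pq.1 + b pq.2)%N * X (G (pq.1 + b pq.2) + ((r : nat)%:Z - m%:Z)) w)) /=.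
apply: eq_bigr => pq _.
rewrite mxE /window_sum mulr_suml mulr_suml mulr_sumr; apply: eq_bigr => r _.
by rewrite /kap; ring.
Qed.

(** For fixed [p] and fixed window shift, [G2] leaves at most two choices of [q]. *)
Let card_phi (i : int) : (#|[pred t | phi t == i]| <= n * (m.*2.+1 * 2))%N.
Proof.
rewrite -sum1_card; under eq_bigl do rewrite inE /=.
rewrite big_mkcond -(pair_bigA _ (fun (pq : 'I_n * 'I_n) (r : 'I_m.*2.+1) =>
  if phi (pq, r) == i then 1 else 0)%N) /=.
rewrite -(pair_bigA _ (fun p q => \sum_r
  if phi ((p, q), r) == i then 1 else 0)%N) /=.
rewrite -[n in X in (_ <= X * _)%N]card_ord -sum_nat_const; apply: leq_sum => p _.
rewrite exchange_big -[X in (_ <= X * _)%N]card_ord -sum_nat_const /=.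
apply: leq_sum => r _.
rewrite -big_mkcond sum1_card; apply: leq_trans (G2 p (i - ((r : nat)%:Z - m%:Z))).
apply: subset_leq_card; apply/fintype.subsetP => q.
rewrite inE; change (phi (p, q, r) == i -> G (p + b q) == i - ((r : nat)%:Z - m%:Z)).
by move=> /eqP <-; rewrite /phi addrK.
Qed.

Let norm_term k t : `|kap * c k (h t)| <= kap.
Proof. by rewrite normrM (ger0_norm kap0) ler_piMr. Qed.

(** By [card_phi], few triples meet a given index, and each weighs at most [kap = n ^ (- 3 / 2)].
    The coefficients are thus of order [n ^ (- 1 / 2)], as the Laplace bounds need. *)
Lemma coef_le (k : 'I_n) (i : int) : `|coef k i| <= 2 * (m.*2.+1)%:R / Num.sqrt n%:R.
Proof.
apply: (le_trans (ler_norm_sum _ _ _)).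
apply: (@le_trans _ _ (\sum_(t | phi t == i) kap)); first exact: ler_sum.
rewrite sumr_const -[leLHS]mulr_natr.
apply: (@le_trans _ _ (kap * (n * (m.*2.+1 * 2))%:R)).
  by apply: ler_wpM2l => //; rewrite ler_nat; exact: card_phi.
rewrite /kap !natrM le_eqVlt; apply/orP; left; apply/eqP; field.
by rewrite pnatr_eq0 -lt0n n0 s0.
Qed.

Lemma sum_sqr_coef_le (k : 'I_n) :
  \sum_(i <- coef_support) coef k i ^+ 2 <= 2 * (m.*2.+1)%:R ^+ 2.
Proof.
pose B : R := 2 * (m.*2.+1)%:R / Num.sqrt n%:R.
have B0 : 0 <= B by rewrite divr_ge0 ?sqrtr_ge0 // mulr_ge0 ?ler0n.
(* Only one of the two factors is unfolded into its triples, [n ^ 2 * (2m + 1)] in all; the other is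
   bounded uniformly by [B]. *)
under eq_bigr do rewrite expr2 [X in X * _]/coef.
rewrite -sum_fibres.
apply: (@le_trans _ _ (\sum_(t : tri) kap * B)).
  apply: ler_sum => t _; apply: (le_trans (ler_norm _)); rewrite normrM.
  exact: ler_pM (norm_term k t) (coef_le k _).
rewrite sumr_const !card_prod !card_ord -[leLHS]mulr_natr !natrM /kap /B.
rewrite le_eqVlt; apply/orP; left; apply/eqP.
have hs : n%:R = Num.sqrt n%:R ^+ 2 :> R by rewrite sqr_sqrtr ?ler0n.
move: s0 hs; move: (Num.sqrt n%:R : R) => s s0' ->.
by field; rewrite s0'.
Qed.

(* The sums [\sum_k c k h * c k h'] are nonnegative, so only the pairs of index
   triples with the same exponent and the same window shift are kept. *)
Lemma sum_sum_sqr_coef_ge :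
  n%:R / 4 <= \sum_k \sum_(i <- coef_support) coef k i ^+ 2.
Proof.
have hlt (t : tri) : (h t < n.*2)%N by rewrite -addnn /h -addSn leq_add // ltnW.
pose key (t : tri) := (Ordinal (hlt t), t.2).
have key_h t t' : key t' = key t -> h t' = h t /\ phi t' = phi t.
  by move=> [] e1 e2; split => //; rewrite /phi e1 e2.
have -> : \sum_k \sum_(i <- coef_support) coef k i ^+ 2 =
    \sum_t \sum_(t' | phi t' == phi t) kap ^+ 2 * \sum_k c k (h t) * c k (h t').
  under eq_bigr => k _.
    under eq_bigr do rewrite expr2 [X in X * _]/coef.
    rewrite -sum_fibres; over.
  rewrite exchange_big; apply: eq_bigr => t _ /=.
  under eq_bigr do rewrite /coef mulr_sumr.
  rewrite exchange_big; apply: eq_bigr => t' _ /=.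
  by rewrite mulr_sumr; apply: eq_bigr => k _; ring.
apply: (@le_trans _ _
  (\sum_t \sum_(t' | key t' == key t) kap ^+ 2 * (n%:R / 2))); last first.
  apply: ler_sum => t _; rewrite [leLHS]big_mkcond [leRHS]big_mkcond.
  apply: ler_sum => t' _; case: eqP => [/key_h[-> ->]|_].
    by rewrite eqxx ler_wpM2l // sqr_ge0.
  by case: ifP => // _; rewrite mulr_ge0 // sqr_ge0.
under eq_bigr do rewrite sumr_const -[_ *+ #|_|]mulr_natr.
rewrite -mulr_sumr.
(* [n / 2] is the ratio of the [n ^ 2 * (2m + 1)] triples to the [2n * (2m + 1)] keys. *)
have := sum_key_collisions key (n%:R / 2 : R).
rewrite !card_prod !card_ord => H.
have K0 : 0 <= kap ^+ 2 * (n%:R / 2) by rewrite mulr_ge0 ?sqr_ge0 ?divr_ge0 ?ler0n.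
have H2 := ler_wpM2l K0 H.
apply: (le_trans _ H2).
have n0' : n%:R != 0 :> R by rewrite pnatr_eq0 -lt0n.
rewrite kapE -(muln2 n) !natrM.
rewrite [leRHS](_ : _ = n%:R / 4 * (m.*2.+1)%:R); last by field.
by rewrite ler_peMr ?divr_ge0 ?ler0n // ler1n.
Qed.

End LinearForm.

(** * Laplace transforms *)

(** This is the square of [1 + x / 2 <= expR (x / 2)], whose left side is nonnegative for
    [x >= - 2]. *)
Lemma expR_quad_ge (R : realType) (x : R) : - 2 <= x ->
  1 + x + x ^+ 2 / 4 <= expR x.
Proof.
move=> x2; have -> : expR x = expR (x / 2) ^+ 2.
  by rewrite -expRM_natr; congr expR; field.
have -> : 1 + x + x ^+ 2 / 4 = (1 + x / 2) ^+ 2 by field.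
rewrite lerXn2r ?nnegrE ?expR_ge0 ?expR_ge1Dx //; lra.
Qed.

(** From [1 - x <= expR (- x)] and [(1 - x) (1 + x + 2 x^2) = 1 + x^2 (1 - 2 x)]. *)
Lemma expR_quad_le (R : realType) (x : R) : x <= 1 / 2 ->
  expR x <= 1 + x + 2 * x ^+ 2.
Proof.
move=> x2; have h : 1 - x <= expR (- x) by rewrite expR_ge1Dx.
have p : 0 < 1 - x by lra.
apply: (@le_trans _ _ (1 - x)^-1).
  by rewrite -[expR x]invrK -expRN lef_pV2 ?posrE ?expR_gt0.
rewrite -[leLHS]mul1r ler_pdivrMr // -subr_ge0.
rewrite [leRHS](_ : _ = x ^+ 2 * (1 - 2 * x)); last by ring.
by rewrite mulr_ge0 ?sqr_ge0 //; lra.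
Qed.

Section FiniteLaw.
Variables (R : realType) (V : finType) (mu x : V -> R) (B : R).
Hypothesis mu0 : forall v, 0 <= mu v.
Hypothesis mu1 : \sum_v mu v = 1.
Hypothesis mean0 : \sum_v x v * mu v = 0.
Hypothesis xB : forall v, `|x v| <= B.
Let s2 : R := \sum_v x v ^+ 2 * mu v.
Variable u : R.
Hypothesis uB : `|u| * B <= 1 / 2.

Let ux v : - (1 / 2) <= u * x v <= 1 / 2.
Proof.
rewrite -ler_norml normrM; apply: le_trans uB.
by apply: ler_wpM2l.
Qed.

(** Centring removes the linear term. The quadratic bounds for [expR] call for [a = 2] above and
    [a = 1 / 4] below. *)
Let moment (a : R) :
  \sum_v (1 + u * x v + a * (u * x v) ^+ 2) * mu v = 1 + a * u ^+ 2 * s2.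
Proof.
have -> : 1 + a * u ^+ 2 * s2 =
    \sum_v mu v + u * \sum_v x v * mu v + a * u ^+ 2 * s2.
  by rewrite mu1 mean0 mulr0 addr0.
rewrite /s2 !mulr_sumr.
by rewrite -!big_split /=; apply: eq_bigr => v _; ring.
Qed.

Lemma laplace_le : \sum_v expR (u * x v) * mu v <= expR (2 * u ^+ 2 * s2).
Proof.
apply: le_trans (expR_ge1Dx _); rewrite -moment; apply: ler_sum => v _.
by apply: ler_wpM2r => //; apply: expR_quad_le; case/andP: (ux v).
Qed.

Lemma laplace_ge : expR (u ^+ 2 * s2 / 8) <= \sum_v expR (u * x v) * mu v.
Proof.
have s20 : 0 <= u ^+ 2 * s2.
  by rewrite mulr_ge0 ?sqr_ge0 // sumr_ge0 // => v _; rewrite mulr_ge0 ?sqr_ge0.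
have s21 : u ^+ 2 * s2 <= 1.
  rewrite /s2 mulr_sumr -mu1; apply: ler_sum => v _.
  rewrite mulrA -exprMn ler_piMl // -real_normK ?num_real // expr_le1 //.
  by rewrite ler_norml; have := ux v; lra.
(* With [y = u ^+ 2 * s2 <= 1], [expR (y / 8) <= 1 + y / 8 + y ^+ 2 / 32 <= 1 + y / 4]. *)
apply: (@le_trans _ _ (1 + 4^-1 * u ^+ 2 * s2)).
  apply: (le_trans (expR_quad_le _)); first by lra.
  move: s20 s21; rewrite -(mulrA 4^-1); set y := u ^+ 2 * s2 => y0 y1.
  have : y ^+ 2 <= y by rewrite expr2 ler_piMl.
  by lra.
rewrite -moment; apply: ler_sum => v _; apply: ler_wpM2r => //.
have := @expR_quad_ge _ (u * x v); rewrite (mulrC _ (4^-1)); apply.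
by have := ux v; lra.
Qed.

End FiniteLaw.

(* With [v = expR (t * x)], [al * v - al ^+ 2 / 4 * v ^+ 2 <= 1], which is
   at most [x - M] as soon as [x >= M + 1]. *)
Lemma expR_truncate (R : realType) (al t M x : R) : 0 <= al -> 0 <= t ->
  al * expR (t * x) <=
  Num.max (x - M) 0 + al * expR (t * (M + 1)) + al ^+ 2 / 4 * expR (2 * t * x).
Proof.
move=> al0 t0; have m0 : 0 <= Num.max (x - M) 0 by rewrite le_max lexx orbT.
have e0 y : 0 <= expR y :> R by exact: expR_ge0.
have q0 : 0 <= al ^+ 2 / 4 * expR (2 * t * x).
  by rewrite mulr_ge0 // divr_ge0 ?sqr_ge0.
have a0 : 0 <= al * expR (t * (M + 1)) by rewrite mulr_ge0.
have [xM|Mx] := leP x (M + 1).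
  have : al * expR (t * x) <= al * expR (t * (M + 1)).
    by rewrite ler_wpM2l // ler_expR ler_wpM2l.
  by lra.
have m1 : 1 <= Num.max (x - M) 0 by rewrite le_max; apply/orP; left; lra.
have -> : expR (2 * t * x) = expR (t * x) ^+ 2.
  by rewrite -expRM_natr; congr expR; ring.
have : 0 <= (1 - al * expR (t * x) / 2) ^+ 2 by exact: sqr_ge0.
have -> : (1 - al * expR (t * x) / 2) ^+ 2 =
    1 - al * expR (t * x) + al ^+ 2 / 4 * expR (t * x) ^+ 2 by field.
by lra.
Qed.

(** * Finite-valued truncation and independence *)

Section SimpleApproximation.
Import HBNNSimple.

Lemma simple_factor (R : realType) (p : {nnsfun R >-> R}) :
  exists (V : finType) (kappa : R -> V) (val : V -> R),
    (forall x, val (kappa x) = p x) /\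
    forall v, measurable (kappa @^-1` [set v]).
Proof.
pose V := fset_set (range p).
have pV x : p x \in V by rewrite in_fset_set ?inE /=; [exists x|exact: fimfunP].
exists V, (fun x => [` pV x]%fset), (fun v => fsval v); split => // v.
have -> : (fun x => [` pV x]%fset) @^-1` [set v] = p @^-1` [set fsval v].
  by apply/seteqP; split => x /= [e]; [rewrite -e|apply/val_inj].
exact: measurable_funPTI.
Qed.

(** The positive and negative parts of the identity are approximated from below by simple functions,
    so the error never exceeds [|x|]; this domination will give convergence in mean square. *)
Lemma simple_approximation (R : realType) :
  exists g : nat -> R -> R,
  [/\ forall x, g n x @[n --> \oo] --> x,
      forall n x, `|x - g n x| <= `|x| &
      forall n, exists (V : finType) (kappa : R -> V) (val : V -> R),
        (forall x, val (kappa x) = g n x) /\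
        forall v, measurable (kappa @^-1` [set v])].
Proof.
have mE : measurable_fun [set: R] (@EFin R) by exact: EFin_measurable.
pose fp := nnsfun_approx measurableT (measurable_funepos mE).
pose fn := nnsfun_approx measurableT (measurable_funeneg mE).
have fpE x : ((@EFin R)^\+ x = (Num.max x 0)%:E)%E.
  by rewrite funeposE -EFin_max.
have fnE x : ((@EFin R)^\- x = (Num.max (- x) 0)%:E)%E.
  by rewrite funenegE -EFinN -EFin_max.
have fple n x : fp n x <= Num.max x 0.
  rewrite -lee_fin -fpE /fp nnsfun_approxE.
  by apply: le_approx => // y _; exact: funepos_ge0.
have fnle n x : fn n x <= Num.max (- x) 0.
  rewrite -lee_fin -fnE /fn nnsfun_approxE.
  by apply: le_approx => // y _; exact: funeneg_ge0.
have fp0 n x : 0 <= fp n x by [].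
have fn0 n x : 0 <= fn n x by [].
have cp x : fp n x @[n --> \oo] --> Num.max x 0.
  have := cvg_nnsfun_approx measurableT (measurable_funepos mE)
    (fun y _ => funepos_ge0 _ y) (I : setT x).
  by rewrite fpE => /fine_cvgP[].
have cn x : fn n x @[n --> \oo] --> Num.max (- x) 0.
  have := cvg_nnsfun_approx measurableT (measurable_funeneg mE)
    (fun y _ => funeneg_ge0 _ y) (I : setT x).
  by rewrite fnE => /fine_cvgP[].
exists (fun n x => fp n x - fn n x); split.
- move=> x; have e : x = Num.max x 0 - Num.max (- x) 0.
    by case: (leP x 0) => x0;
      [rewrite max_l ?oppr_ge0 // sub0r opprK
      |rewrite max_r ?subr0 ?oppr_le0 ?(ltW x0)].
  rewrite [X in _ --> X]e; exact: cvgB.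
- move=> n x; have := fple n x; have := fnle n x; have := fp0 n x; have := fn0 n x.
  case: (leP x 0) => x0.
    rewrite max_l ?oppr_ge0 // => a b c e.
    by rewrite ler_norml (ler0_norm x0); apply/andP; split; lra.
  rewrite max_r ?oppr_le0 ?(ltW x0) // => a b c e.
  by rewrite ler_norml (gtr0_norm x0); apply/andP; split; lra.
move=> n; have [V1 [k1 [v1 [e1 m1]]]] := simple_factor (fp n).
have [V2 [k2 [v2 [e2 m2]]]] := simple_factor (fn n).
exists (V1 * V2)%type, (fun x => (k1 x, k2 x)), (fun v => v1 v.1 - v2 v.2); split.
  by move=> x /=; rewrite e1 e2.
move=> [a b].
have -> : (fun x => (k1 x, k2 x)) @^-1` [set (a, b)] =
   (k1 @^-1` [set a]) `&` (k2 @^-1` [set b]).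
  by apply/seteqP; split => x /=; [case|case=> -> ->].
exact: measurableI.
Qed.

End SimpleApproximation.

(** [V] carries no sigma-algebra, so the function is written as a finite combination of indicators
    of the fibres of [kappa]. *)
Lemma measurable_finite_factor (R : realType) (d : measure_display)
    (T : measurableType d) (Y : T -> R) (V : finType) (kappa : R -> V)
    (f : V -> R) : measurable_fun setT Y ->
  (forall v, measurable (kappa @^-1` [set v])) ->
  measurable_fun setT (fun w => f (kappa (Y w))).
Proof.
move=> mY kappa_meas; have -> : (fun w => f (kappa (Y w))) =
    (fun w => \sum_v f v * \1_(Y @^-1` (kappa @^-1` [set v])) w).
  apply/funext => w; rewrite (bigD1 (kappa (Y w))) //= indicE mem_set //= mulr1.
  rewrite big1 ?addr0 // => v vk; rewrite indicE memNset ?mulr0 //=.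
  by move=> e; move: vk; rewrite e eqxx.
apply: measurable_sum => v; apply: measurable_funM => //.
apply: measurable_indic; rewrite -[_ @^-1` _]setTI; exact: mY.
Qed.

Lemma integral_probability_cst (R : realType) (d : measure_display)
    (T : measurableType d) (P : probability T R) (r : R) :
  (\int[P]_w r%:E = r%:E)%E.
Proof.
rewrite integral_cst // [X in (_ * X)%E](_ : _ = 1%E) ?mule1 //.
exact: probability_setT.
Qed.

Section FiniteFactor.
Variables (R : realType) (d : measure_display) (T : measurableType d).
Variables (P : probability T R) (Y : {RV P >-> R}).

Lemma integral_finite_factor (V : finType) (kappa : R -> V) (mu f : V -> R) :
  (forall v, measurable (kappa @^-1` [set v])) ->
  (forall v, P (Y @^-1` (kappa @^-1` [set v])) = (mu v)%:E) ->
  P.-integrable setT (fun w => (f (kappa (Y w)))%:E) /\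
  (\int[P]_w (f (kappa (Y w)))%:E = (\sum_v f v * mu v)%:E)%E.
Proof.
move=> mk muE.
have mB v : measurable (Y @^-1` (kappa @^-1` [set v])) by exact: measurable_funPTI.
have E w : (f (kappa (Y w)))%:E =
    (\sum_v (f v)%:E * (\1_(Y @^-1` (kappa @^-1` [set v])) w)%:E)%E.
  rewrite (bigD1 (kappa (Y w))) //= indicE mem_set //= mule1.
  rewrite big1 ?adde0 // => v vk; rewrite indicE memNset ?mule0 //=.
  by move=> e; move: vk; rewrite e eqxx.
have I v : P.-integrable setT
    (fun w => (f v)%:E * (\1_(Y @^-1` (kappa @^-1` [set v])) w)%:E)%E.
  by apply: integrableZl => //; exact: integrable_indic.
rewrite (funext E); split; first by apply: integrable_sum.
rewrite integral_sum // -sumEFin; apply: eq_bigr => v _.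
rewrite integralZl //; last exact: integrable_indic.
by rewrite integral_indic // setIT EFinM; congr (_ * _)%E; exact: muE.
Qed.

Lemma finite_law_sum (V : finType) (kappa : R -> V) (mu : V -> R) :
  (forall v, measurable (kappa @^-1` [set v])) ->
  (forall v, P (Y @^-1` (kappa @^-1` [set v])) = (mu v)%:E) ->
  (forall v, 0 <= mu v) /\ \sum_v mu v = 1.
Proof.
move=> mk muE; split; first by move=> v; rewrite -lee_fin -muE measure_ge0.
have [_] := integral_finite_factor (fun=> 1) mk muE.
rewrite integral_probability_cst => -[h]; rewrite [RHS]h.
by apply: eq_bigr => u _; rewrite mul1r.
Qed.

Hypothesis Y_sqr : (\int[P]_w ((Y w) ^+ 2)%:E = 1)%E.
Hypothesis Y_mean : (\int[P]_w (Y w)%:E = 0)%E.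

Let mY : measurable_fun setT Y. Proof. exact: measurable_funP. Qed.

Lemma square_integrable : P.-integrable setT (fun w => ((Y w) ^+ 2)%:E).
Proof.
apply/integrableP; split; first by apply/measurable_EFinP; exact: measurable_funX.
under eq_integral do rewrite gee0_abs ?lee_fin ?sqr_ge0 //.
by rewrite Y_sqr ltey.
Qed.

Lemma integrable_of_square : P.-integrable setT (fun w => (Y w)%:E).
Proof.
apply: (le_integrable measurableT (g := fun w => (1%:E + ((Y w) ^+ 2)%:E)%E)).
- exact/measurable_EFinP.
- move=> w _; rewrite -EFinD !abse_EFin lee_fin.
  rewrite [leRHS]ger0_norm ?addr_ge0 ?sqr_ge0 //.
  rewrite -(@real_normK _ (Y w)) ?num_real // -subr_ge0.
  have -> : 1 + `|Y w| ^+ 2 - `|Y w| = (`|Y w| - 2^-1) ^+ 2 + 3 / 4 by field.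
  by rewrite addr_ge0 ?sqr_ge0 // divr_ge0.
apply: integrableD => //; last exact: square_integrable.
exact: (finite_measure_integrable_cst P 1).
Qed.

(** Simple approximations converge to [Y] in mean square by dominated convergence, the squared error
    being at most [Y ^+ 2]; a good one is then centred. *)
Lemma finite_truncation (eta : R) : 0 < eta ->
  exists (V : finType) (kappa : R -> V) (mu x : V -> R),
  [/\ forall v, measurable (kappa @^-1` [set v]),
      forall v, P (Y @^-1` (kappa @^-1` [set v])) = (mu v)%:E,
      \sum_v x v * mu v = 0 &
      (\int[P]_w ((Y w - x (kappa (Y w))) ^+ 2)%:E <= eta%:E)%E].
Proof.
move=> eta0; have [g [cg gle gfin]] := simple_approximation R.
have mg n : measurable_fun setT (fun w => g n (Y w)).
  have [V [k [v [e m]]]] := gfin n.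
  have -> : (fun w => g n (Y w)) = (fun w => v (k (Y w))).
    by apply/funext => w; rewrite e.
  exact: (measurable_finite_factor _ mY m).
pose err n w := ((Y w - g n (Y w)) ^+ 2)%:E : \bar R.
have merr n : measurable_fun setT (err n).
  by apply/measurable_EFinP; apply: measurable_funX; exact: measurable_funB.
have errle n w : (`|err n w| <= ((Y w) ^+ 2)%:E)%E.
  rewrite /err abse_EFin lee_fin ger0_norm ?sqr_ge0 //.
  rewrite -(@real_normK _ (Y w)) ?num_real // -real_normK ?num_real //.
  by rewrite lerXn2r ?nnegrE.
have errc w : (err ^~ w @ \oo --> 0)%E.
  apply/fine_cvgP; split; first exact: nearW.
  rewrite -[X in _ --> X](_ : (Y w - Y w) * (Y w - Y w) = 0); last first.
    by rewrite subrr mul0r.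
  by apply: cvgM; apply: cvgB; [exact: cvg_cst|exact: cg|exact: cvg_cst|exact: cg].
have [_ _] := @dominated_convergence _ _ _ P setT measurableT err (cst 0%E)
  (fun w => ((Y w) ^+ 2)%:E) merr (measurable_cst _) (aeW _ (fun w _ => errc w))
  square_integrable (aeW _ (fun w n _ => errle n w)).
rewrite integral0 => cvg_err.
have [n Hn] : exists n, (\int[P]_w err n w <= eta%:E)%E.
  have /fine_cvgP[F C] := cvg_err.
  have C' : \forall n \near \oo, `|fine (\int[P]_w err n w)%E| < eta.
    exact: (@cvgr0_norm_lt _ _ _ _ _ (fun n => fine (\int[P]_w err n w)%E)).
  have [n [/= Fn Cn]] := filter_ex (filterI F C').
  exists n; rewrite -(fineK Fn) lee_fin (le_trans (ler_norm _)) //; exact: ltW.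
have [V [kappa [v [e mk]]]] := gfin n.
pose mu u := fine (P (Y @^-1` (kappa @^-1` [set u]))).
have mB u : measurable (Y @^-1` (kappa @^-1` [set u])) by exact: measurable_funPTI.
have muE u : P (Y @^-1` (kappa @^-1` [set u])) = (mu u)%:E.
  by rewrite /mu fineK // fin_num_measure.
pose c := \sum_u v u * mu u.
have [Ig gE] := integral_finite_factor v mk muE.
have [_ mu1] := finite_law_sum mk muE.
exists V, kappa, mu, (fun u => v u - c); split => //.
  under eq_bigr do rewrite mulrBl.
  by rewrite sumrB -mulr_sumr mu1 mulr1 subrr.
pose e1 w := ((Y w)%:E + (- 1)%:E * (v (kappa (Y w)))%:E)%E.
have Ie1 : P.-integrable setT e1.
  apply: integrableD => //; first exact: integrable_of_square.
  by apply: integrableZl.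
have Ierr : P.-integrable setT (err n).
  apply: le_integrable square_integrable => // w _.
  by apply: (le_trans (errle n w)); rewrite lee_abs.
have Icst : P.-integrable setT (cst (c ^+ 2)%:E).
  exact: (finite_measure_integrable_cst P (c ^+ 2)).
have e1E : (\int[P]_w e1 w = (- c)%:E)%E.
  rewrite /e1 integralD //; [|exact: integrable_of_square|exact: integrableZl].
  by rewrite integralZl // Y_mean add0e gE -EFinM mulN1r.
(* Centring does no harm: as [Y] has mean 0, it lowers the mean square error by [c ^+ 2]. *)
have -> : (fun w => ((Y w - (v (kappa (Y w)) - c)) ^+ 2)%:E) =
    (fun w => (err n w + ((2 * c)%:E * e1 w + cst (c ^+ 2)%:E w))%E).
  apply/funext => w; rewrite /e1 /err /cst -e -!(EFinM, EFinD).
  by congr _%:E; ring.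
rewrite integralD //; last by apply: integrableD => //; exact: integrableZl.
rewrite integralD //; last exact: integrableZl.
rewrite integralZl // e1E integral_probability_cst.
rewrite -EFinM -EFinD; apply: le_trans Hn.
rewrite -[leRHS]adde0; apply: leeD => //; rewrite lee_fin.
have := sqr_ge0 c; rewrite expr2; lra.
Qed.

End FiniteFactor.

Section Independence.
Variables (R : realType) (d : measure_display) (T : measurableType d).
Variables (P : probability T R) (I : choiceType) (X : I -> {RV P >-> R}).
Hypothesis X_indep : mutually_independent X.
Hypothesis X_ident : identically_distributed X.
Variables (V : finType) (kappa : R -> V).
Hypothesis kappa_meas : forall v, measurable (kappa @^-1` [set v]).
Variables (i0 : I) (mu : V -> R).
Hypothesis muE : forall v, P (X i0 @^-1` (kappa @^-1` [set v])) = (mu v)%:E.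

Let muE' i v : P (X i @^-1` (kappa @^-1` [set v])) = (mu v)%:E.
Proof. by rewrite -muE; exact: (X_ident i i0 (kappa_meas v)). Qed.

(* The sequence [s2] collects the indices whose factor has already been expanded
   into indicators of the fibres of [kappa]. *)
Lemma expectation_prod_indep_mixed (s1 s2 : seq I) (u : I -> V) (f : I -> V -> R) :
  uniq (s1 ++ s2) -> (forall i v, 0 <= f i v) ->
  (\int[P]_w (\prod_(i <- s1) f i (kappa (X i w)) *
             \prod_(i <- s2) (kappa (X i w) == u i)%:R)%:E =
  (\prod_(i <- s1) (\sum_v f i v * mu v) * \prod_(i <- s2) mu (u i))%:E)%E.
Proof.
elim: s1 s2 u => [|i s1 IH] s2 u us f0.
  under eq_integral do rewrite big_nil mul1r.
  rewrite big_nil mul1r.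
  (* Only indicators are left; their product is the indicator of the intersection [E], to which
     independence applies. *)
  have := X_indep us (fun i => kappa_meas (u i)).
  under [in RHS]eq_bigr do rewrite muE'.
  rewrite prodEFin => <-.
  set E := \bigcap_(i in _) _.
  have mE : measurable E.
    rewrite /E bigcap_seq; apply: bigsetI_measurable => i _.
    exact: measurable_funPTI.
  rewrite -[in RHS](setIT E) -integral_indic //.
  apply: eq_integral => w _; congr (_%:E).
  rewrite indicE; have [b|b] := boolP (all (fun i => kappa (X i w) == u i) s2).
    rewrite big1_seq => [|i /andP[_ /(allP b) ->]] //.
    by rewrite mem_set // => i /= /(allP b) /eqP.
  have /allPn [i is2 ne] := b.
  rewrite (big_rem i) //= (negPf ne) mul0r memNset //.
  by move=> /(_ i is2) /=; apply/eqP.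
have f00 w : 0 <= \prod_(i <- s1) f i (kappa (X i w)).
  by apply: prodr_ge0 => j _.
have g00 (s : seq I) v w : 0 <= \prod_(j <- s) (kappa (X j w) == v j)%:R :> R.
  by apply: prodr_ge0 => j _; exact: ler0n.
have mprod (s : seq I) (g : I -> V -> R) :
    measurable_fun setT (fun w => \prod_(j <- s) g j (kappa (X j w))).
  apply: measurable_prod => j _.
  exact: (measurable_finite_factor _ (measurable_funP _) kappa_meas).
have meas v : measurable_fun setT (fun w =>
   (\prod_(j <- s1) f j (kappa (X j w)) *
     \prod_(j <- i :: s2) (kappa (X j w) ==
       (if j == i then v else u j))%:R)%:E : \bar R).
  apply/measurable_EFinP; apply: measurable_funM; first exact: mprod.
  exact: (mprod (i :: s2) (fun j x => (x == (if j == i then v else u j))%:R)).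
(* The factor at [i] is split over the values [v] of [kappa (X i w)]; its indicator joins [s2] with
   target [v], the other targets being kept since [i] is not in [s2]. *)
transitivity (\int[P]_w \sum_v ((f i v)%:E *
   (\prod_(j <- s1) f j (kappa (X j w)) *
     \prod_(j <- i :: s2) (kappa (X j w) == (if j == i then v else u j))%:R)%:E))%E.
  apply: eq_integral => w _; rewrite sumEFin; congr (_%:E).
  rewrite big_cons (bigD1 (kappa (X i w))) //=.
  rewrite [X in _ = _ + X]big1 ?addr0 => [|v vk]; last first.
    by rewrite big_cons eqxx eq_sym (negPf vk) mul0r !mulr0.
  rewrite big_cons !eqxx mul1r -mulrA; congr (_ * (_ * _)).
  apply: eq_big_seq => j js2; case: (j =P i) => // ji.
  by move: us js2; rewrite cat_cons /= mem_cat ji => /andP[/norP[_ /negPf ->]].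
rewrite ge0_integral_sum //; first last.
- by move=> v w _; rewrite mule_ge0 // lee_fin ?f0 // mulr_ge0.
- by move=> v; exact: measurable_funeM.
have us' : uniq (s1 ++ i :: s2).
  rewrite (perm_uniq (_ : perm_eq _ ((i :: s1) ++ s2))) //.
  by rewrite -[i :: s2]cat1s perm_catCA.
transitivity (\sum_v (f i v * (\prod_(j <- s1) (\sum_x f j x * mu x) *
   (mu v * \prod_(j <- s2) mu (u j))))%:E)%E.
  apply: eq_bigr => v _; rewrite ge0_integralZl ?lee_fin ?f0 //; last first.
    by move=> w _; rewrite lee_fin mulr_ge0.
  rewrite IH // -EFinM; congr (_ * (_ * _))%:E.
  rewrite big_cons eqxx; congr (_ * _).
  apply: eq_big_seq => j js2; case: (j =P i) => // ji.
  by move: us js2; rewrite cat_cons /= mem_cat ji => /andP[/norP[_ /negPf ->]].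
rewrite sumEFin; congr (_%:E); rewrite big_cons !mulr_suml.
by apply: eq_bigr => v _; ring.
Qed.

Lemma expectation_prod_indep (s : seq I) (f : I -> V -> R) :
  uniq s -> (forall i v, 0 <= f i v) ->
  (\int[P]_w (\prod_(i <- s) f i (kappa (X i w)))%:E =
  (\prod_(i <- s) (\sum_v f i v * mu v))%:E)%E.
Proof.
move=> us f0.
have := @expectation_prod_indep_mixed s [::] (fun=> kappa 0) f.
rewrite cats0 big_nil mulr1 => /(_ us f0) <-.
by apply: eq_integral => w _; rewrite big_nil mulr1.
Qed.

End Independence.

(** * Bounded support *)

(** Every point outside the support lies in a null interval with rational endpoints, and there are
    countably many of these. *)
Lemma negligible_compl_msupport (R : realType) (L : probability R R) :
  L.-negligible (~` msupport L).
Proof.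
pose I (ab : rat * rat) : set R := `]ratr ab.1, ratr ab.2[%classic.
pose F (n : nat) : set R := if unpickle n is Some ab then
  if L (I ab) == 0%E then I ab else set0 else set0.
apply: (@negligibleS _ _ _ _ (\bigcup_n F n)); last first.
  apply: negligible_bigcup => n; rewrite /F.
  case: unpickle => [ab|]; last exact: negligible_set0.
  case: eqP => [L0|_]; last exact: negligible_set0.
  by apply/negligibleP => //; exact: measurable_itv.
move=> x /= nx.
have [U [oU [Ux LU]]] : exists U : set R, open U /\ U x /\ L U = 0%E.
  apply: contrapT => H; apply: nx => U oU Ux; rewrite lt0e measure_ge0 andbT.
  by apply/eqP => LU; apply: H; exists U.
have [r /= r0 rU] : nbhs_ball x U by rewrite nbhs_ballE; exact: open_nbhs_nbhs.
have [a /[!in_itv]/= /andP[a1 a2]] : exists q, ratr q \in `](x - r), x[.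
  by apply: rat_in_itvoo; rewrite ltrBlDr ltrDl.
have [b /[!in_itv]/= /andP[b1 b2]] : exists q, ratr q \in `]x, (x + r)[.
  by apply: rat_in_itvoo; rewrite ltrDl.
have IU : I (a, b) `<=` U.
  move=> y; rewrite /I /= in_itv /= => /andP[y1 y2]; apply: rU.
  by rewrite /ball /= ltr_distlC; apply/andP; split; lra.
have LI : L (I (a, b)) = 0%E.
  apply/eqP; rewrite -measure_le0 -LU; apply: le_measure => //; rewrite inE.
    exact: measurable_itv.
  exact: open_measurable.
have [n Fn] : exists n, F n = I (a, b).
  by exists (pickle (a, b)); rewrite /F pickleK LI eqxx.
exists n; first exact: Logic.I.
by rewrite Fn /I /= in_itv /= a2 b1.
Qed.

Lemma bounded_support_dist_fun (R : realType) (L : probability R R) :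
  bounded_set (msupport L) -> exists M : R, 0 <= M /\
  (forall x, M < x -> dist_fun L x = 1) /\
  (forall x, x < - M -> dist_fun L x = 0).
Proof.
move=> [M0 [_ HM]]; pose M := `|M0| + 1.
have supp x : M < `|x| -> (~` msupport L) x.
  move=> Mx /= sx; have HM' : `|x| <= M.
    by apply: (HM M) => //; rewrite /M; have := ler_norm M0; lra.
  by move: HM'; rewrite leNgt Mx.
have nul (B : set R) : measurable B -> (forall x, B x -> M < `|x|) -> L B = 0%E.
  move=> mB HB; apply: measure_negligible => //.
  by apply: negligibleS (negligible_compl_msupport L) => x /HB /supp.
have Mpos : 0 <= M by rewrite /M addr_ge0.
exists M; split => //; split => x xM; rewrite /dist_fun.
  have -> : `]-oo, x]%classic = ~` (`]x, +oo[%classic : set R).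
    by rewrite setCitvr.
  rewrite probability_setC; last exact: measurable_itv.
  rewrite nul ?sube0 //.
  move=> y /=; rewrite in_itv /= andbT => xy.
  by rewrite (lt_le_trans (lt_trans xM xy)) // ler_norm.
rewrite nul // => y /=; rewrite in_itv /= => yx.
by rewrite -normrN (lt_le_trans _ (ler_norm _)) // ltrNr (le_lt_trans yx).
Qed.

Lemma lsd_bounded_support (R : realType) (d : measure_display)
    (T : measurableType d) (P : probability T R)
    (A : forall n : nat, T -> 'M[R]_n) (L : probability R R) :
  is_lsd P A L -> bounded_set (msupport L) ->
  exists M : R, 0 <= M /\
    {ae P, forall w, 1 - esd (A n w) M + esd (A n w) (- M) @[n --> \oo] --> (0 : R)}.
Proof.
move=> lsd /bounded_support_dist_fun [M [M0 [F1 F0]]].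
(* The distribution function is constant near [M + 1] and near [- (M + 1)], so both are continuity
   points, where weak convergence applies. *)
exists (M + 1); split; first by rewrite addr_ge0.
apply: filterS lsd => w cvw.
have M1 : M < M + 1 by rewrite ltrDl.
have k1 : {for M + 1, continuous (dist_fun L)}.
  apply: cvg_near_cst; near=> y; rewrite !F1 //.
  by near: y; exact: lt_nbhsr.
have k0 : {for - (M + 1), continuous (dist_fun L)}.
  apply: cvg_near_cst; near=> y; rewrite !F0 ?ltrN2 //.
  by near: y; apply: lt_nbhsl; rewrite ltrN2.
have := cvw _ k1; rewrite F1 // => c1.
have := cvw _ k0; rewrite F0 ?ltrN2 // => c0.
rewrite [X in _ --> X](_ : 0 = 1 - 1 + 0 :> R); last by rewrite subrr addr0.
by apply: cvgD => //; apply: cvgB => //; exact: cvg_cst.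
Unshelve. all: by end_near. Qed.

(** * Averaged exponential moments of the compressions *)

Lemma sum_expR_ge (R : realType) (n : nat) (u : 'I_n -> R) (v : R) :
  n%:R * v <= \sum_k u k -> n%:R * expR v <= \sum_k expR (u k).
Proof.
move=> nv; apply: (@le_trans _ _ (\sum_k expR v * (1 + (u k - v)))).
  rewrite -mulr_sumr mulrC ler_wpM2l ?expR_ge0 //.
  by rewrite big_split /= sumrB !sumr_const card_ord -mulr_natl; lra.
apply: ler_sum => k _.
have -> : expR (u k) = expR v * expR (u k - v) by rewrite -expRD addrC subrK.
by rewrite ler_wpM2l ?expR_ge0 ?expR_ge1Dx.
Qed.

Section LaplaceCompression.
Variables (R : realType) (V : finType) (mu x : V -> R) (B : R).
Hypothesis mu0 : forall v, 0 <= mu v.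
Hypothesis mu1 : \sum_v mu v = 1.
Hypothesis mean0 : \sum_v x v * mu v = 0.
Hypothesis xB : forall v, `|x v| <= B.
Let s2 : R := \sum_v x v ^+ 2 * mu v.
Variables (I : eqType) (n : nat) (s : seq I) (a : 'I_n -> I -> R) (t C : R).

(** By independence this will be the mean of [expR (t * D_k)], where [D_k] is the [k]-th compression
    of the truncated noise. *)
Definition laplace_prod (t : R) (k : 'I_n) : R :=
  \prod_(i <- s) \sum_v expR (t * (a k i * x v)) * mu v.

Hypothesis aB : forall k i, `|2 * t * a k i| * B <= 1 / 2.
Hypothesis aC : forall k, \sum_(i <- s) a k i ^+ 2 <= C.
Hypothesis aS : n%:R / 4 <= \sum_k \sum_(i <- s) a k i ^+ 2.

Let s20 : 0 <= s2.
Proof. by rewrite sumr_ge0 // => v _; rewrite mulr_ge0 ?sqr_ge0. Qed.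

Let B0 (v : V) : 0 <= B. Proof. exact: le_trans (xB v). Qed.

Lemma sum_laplace_prod_le :
  \sum_k laplace_prod (2 * t) k <= n%:R * expR (8 * t ^+ 2 * s2 * C).
Proof.
rewrite (_ : n%:R * _ = \sum_(k < n) expR (8 * t ^+ 2 * s2 * C)); last first.
  by rewrite sumr_const card_ord [LHS]mulr_natl.
apply: ler_sum => k _.
apply: (@le_trans _ _ (\prod_(i <- s) expR (2 * (2 * t * a k i) ^+ 2 * s2))).
  apply: ler_prod => i _; apply/andP; split.
    by apply: sumr_ge0 => v _; rewrite mulr_ge0 ?expR_ge0.
  under eq_bigr do rewrite mulrA.
  exact: (laplace_le mu0 mu1 mean0 xB (aB k i)).
rewrite -expR_sum ler_expR.
rewrite (eq_bigr (fun i => 8 * t ^+ 2 * s2 * a k i ^+ 2)); last by move=> i _; ring.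
by rewrite -mulr_sumr ler_wpM2l // mulr_ge0 // mulr_ge0 // sqr_ge0.
Qed.

(** Only the average over [k] of the variances is bounded below, so [laplace_ge] is combined with
    Jensen's inequality over [k]. *)
Lemma sum_laplace_prod_ge :
  n%:R * expR (t ^+ 2 * s2 / 32) <= \sum_k laplace_prod t k.
Proof.
apply: (@le_trans _ _ (\sum_k expR (t ^+ 2 * s2 / 8 * \sum_(i <- s) a k i ^+ 2))).
  apply: sum_expR_ge; rewrite -mulr_sumr.
  rewrite (_ : n%:R * _ = t ^+ 2 * s2 / 8 * (n%:R / 4)); last by field.
  by rewrite ler_wpM2l // divr_ge0 // mulr_ge0 // sqr_ge0.
apply: ler_sum => k _; rewrite mulr_sumr expR_sum.
apply: ler_prod => i _; rewrite expR_ge0 /=.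
under [leRHS]eq_bigr do rewrite mulrA.
have -> : t ^+ 2 * s2 / 8 * a k i ^+ 2 = (t * a k i) ^+ 2 * s2 / 8 by field.
apply: (laplace_ge mu0 mu1 mean0 xB).
apply: le_trans (aB k i); rewrite -mulrA [in leRHS]normrM.
have [v _|] := pickP (fun v : V => true); last first.
  by move=> e; move: mu1; rewrite big_pred0 // => /eqP; rewrite eq_sym oner_eq0.
rewrite (ger0_norm (ler0n R 2)) -mulrA ler_peMl ?ler1n // mulr_ge0 //; exact: B0 v.
Qed.

End LaplaceCompression.

(** * The mean excess of the compressions *)

Section MeanLe.
Variables (R : realType) (d : measure_display) (T : measurableType d).
Variable P : probability T R.

(** Upper bound on an expectation, packaged with what the integral of a nonnegative function asks
    for, so that sums and multiples raise no integrability question. *)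
Definition mean_le (f : T -> R) (e : R) : Prop :=
  [/\ measurable_fun setT f, forall w, 0 <= f w & (\int[P]_w (f w)%:E <= e%:E)%E].

Lemma mean_le_sum (I : Type) (s : seq I) (f : I -> T -> R) (e : I -> R) :
  (forall i, mean_le (f i) (e i)) ->
  mean_le (fun w => \sum_(i <- s) f i w) (\sum_(i <- s) e i).
Proof.
move=> H; split.
- by apply: measurable_sum => i; have [] := H i.
- by move=> w; apply: sumr_ge0 => i _; have [_ + _] := H i; apply.
under eq_integral do rewrite -sumEFin.
rewrite ge0_integral_sum //.
- by rewrite -sumEFin; apply: lee_sum => i _; have [] := H i.
- by move=> i; apply/measurable_EFinP; have [] := H i.
- by move=> i w _; rewrite lee_fin; have [_ + _] := H i; apply.
Qed.

Lemma mean_leD (f g : T -> R) (e e' : R) :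
  mean_le f e -> mean_le g e' -> mean_le (fun w => f w + g w) (e + e').
Proof.
move=> [mf f0 fe] [mg g0 ge]; split.
- exact: measurable_funD.
- by move=> w; rewrite addr_ge0.
under eq_integral do rewrite EFinD.
rewrite ge0_integralD //; last 4 first.
- by move=> w _; rewrite lee_fin.
- exact/measurable_EFinP.
- by move=> w _; rewrite lee_fin.
- exact/measurable_EFinP.
by rewrite EFinD leeD.
Qed.

Lemma mean_leZ (c : R) (f : T -> R) (e : R) :
  0 <= c -> mean_le f e -> mean_le (fun w => c * f w) (c * e).
Proof.
move=> c0 [mf f0 fe]; split.
- exact: measurable_funM.
- by move=> w; rewrite mulr_ge0.
under eq_integral do rewrite EFinM.
rewrite ge0_integralZl //; last 2 first.
- exact/measurable_EFinP.
- by move=> w _; rewrite lee_fin.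
by rewrite EFinM lee_wpmul2l ?lee_fin.
Qed.

Lemma mean_le_cst (c : R) : 0 <= c -> mean_le (fun=> c) c.
Proof.
move=> c0; split => //; rewrite integral_probability_cst //.
Qed.

Lemma mean_le_mono (f g : T -> R) (e : R) : measurable_fun setT f ->
  (forall w, 0 <= f w <= g w) -> mean_le g e -> mean_le f e.
Proof.
move=> mf fg [mg g0 ge]; split => //.
  by move=> w; have /andP[] := fg w.
apply: le_trans ge; apply: ge0_le_integral => //.
- by move=> w _; rewrite lee_fin; have /andP[] := fg w.
- exact/measurable_EFinP.
- exact/measurable_EFinP.
- by move=> w _; rewrite lee_fin; have /andP[] := fg w.
Qed.

(** Dominated convergence with the constant [K] as dominating function: [h n] tends to 0 almost
    surely, being squeezed by [K * p n]. *)
Lemma mean_le_near (h p : nat -> T -> R) (K e : R) : 0 < e ->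
  (forall n, measurable_fun setT (h n)) ->
  (forall n w, 0 <= h n w <= K * p n w) -> (forall n w, K * p n w <= K) ->
  {ae P, forall w, p n w @[n --> \oo] --> (0 : R)} ->
  \forall n \near \oo, mean_le (h n) e.
Proof.
move=> e0 mh hp pK p0.
pose f n w := (h n w)%:E : \bar R.
have mf n : measurable_fun setT (f n) by exact/measurable_EFinP.
have ae0 : {ae P, forall w, setT w -> f ^~ w @ \oo --> cst 0%E w}.
  apply: filterS p0 => w cw _; apply/fine_cvgP; split; first exact: nearW.
  apply: (@squeeze_cvgr _ _ _ _ (fun=> 0) (fun n => K * p n w)).
  - by apply: nearW => n; exact: hp.
  - exact: cvg_cst.
  - by rewrite -[X in _ --> X](mulr0 K); apply: cvgM => //; exact: cvg_cst.
have dom : {ae P, forall w n, setT w -> (`|f n w| <= cst K%:E w)%E}.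
  apply: aeW => w n _; rewrite /f abse_EFin lee_fin.
  by have /andP[a b] := hp n w; rewrite ger0_norm // (le_trans b).
have [_ _] := @dominated_convergence _ _ _ P setT measurableT f (cst 0%E)
  (cst K%:E) mf (measurable_cst _) ae0
  (finite_measure_integrable_cst P K measurableT) dom.
rewrite integral0 => /fine_cvgP[F C].
have C' : \forall n \near \oo, `|fine (\int[P]_w f n w)%E| < e.
  exact: (@cvgr0_norm_lt _ _ _ _ _ (fun n => fine (\int[P]_w f n w)%E)).
near=> n; split => //.
  by move=> w; have /andP[] := hp n w.
have Fn : (\int[P]_w f n w)%E \is a fin_num by near: n.
rewrite -/(f n _) -(fineK Fn) lee_fin (le_trans (ler_norm _)) // ltW //.
by near: n.
Unshelve. all: by end_near. Qed.

End MeanLe.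

(** * Second moments of the window matrices and the truncation error *)

Lemma integral_sqr_of_variance (R : realType) (d : measure_display)
    (T : measurableType d) (P : probability T R) (Y : {RV P >-> R}) :
  ('E_P[Y] = 0)%E -> ('V_P[Y] = 1)%E ->
  (\int[P]_w (Y w)%:E = 0)%E /\ (\int[P]_w ((Y w) ^+ 2)%:E = 1)%E.
Proof.
move=> E0; rewrite /variance unlock E0 /= unlock => <-.
split; first by rewrite -E0 unlock.
apply: eq_integral => w _; congr _%:E.
by transitivity ((Y w - 0) * (Y w - 0)); first by rewrite !subr0 expr2.
Qed.

Lemma ident_ge0_integral (R : realType) (d : measure_display)
    (T : measurableType d) (P : probability T R) (I : choiceType)
    (X : I -> {RV P >-> R}) (f : R -> R) (i j : I) :
  identically_distributed X -> measurable_fun setT f -> (forall y, 0 <= f y) ->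
  (\int[P]_w (f (X i w))%:E = \int[P]_w (f (X j w))%:E)%E.
Proof.
move=> id mf f0.
have mEf : measurable_fun setT (EFin \o f) by exact/measurable_EFinP.
have f0' y : (0 <= (EFin \o f) y)%E by rewrite lee_fin.
have := ge0_integral_distribution (X i) mEf f0'.
have := ge0_integral_distribution (X j) mEf f0'.
rewrite /comp => <- <-; apply: eq_measure_integral => A mA _.
exact: id.
Qed.

Lemma sqr_sum_le (R : realType) (n : nat) (y : 'I_n -> R) :
  (\sum_r y r) ^+ 2 <= n%:R * \sum_r y r ^+ 2.
Proof.
case: n y => [|n] y; first by rewrite !big_ord0 expr0n mul0r.
pose t := (\sum_r y r) / n.+1%:R.
have n0 : n.+1%:R != 0 :> R by rewrite pnatr_eq0.
have -> : (\sum_r y r) ^+ 2 = n.+1%:R * (2 * t * \sum_r y r - t ^+ 2 * n.+1%:R).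
  by rewrite /t; field; rewrite -[1 + _]/(1 + n%:R) addrC natr1.
rewrite ler_wpM2l // mulr_sumr -[n.+1%:R](_ : \sum_(r < n.+1) 1 = _); last first.
  by rewrite sumr_const card_ord.
rewrite mulr_sumr -sumrB; apply: ler_sum => r _.
rewrite -subr_ge0 (_ : _ - _ = (y r - t) ^+ 2) ?sqr_ge0 //; ring.
Qed.

(** By Cauchy-Schwarz over the window, each of the [n ^ 2] entries has mean square at most
    [(2m + 1) ^ 2 * e / n]. *)
Lemma mean_le_window_matrix (R : realType) (d : measure_display)
    (T : measurableType d) (P : probability T R) (m n : nat)
    (g : 'I_n -> 'I_n -> int) (Z : int -> T -> R) (e : R) : (0 < n)%N ->
  (forall i, measurable_fun setT (Z i)) ->
  (forall i, mean_le P (fun w => Z i w ^+ 2) e) ->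
  mean_le P (fun w => \sum_i \sum_j window_matrix m g Z w i j ^+ 2)
    (n%:R * (m.*2.+1)%:R ^+ 2 * e).
Proof.
move=> n0 mZ Ze; pose q : R := (m.*2.+1)%:R.
have n0' : n%:R != 0 :> R by rewrite pnatr_eq0 -lt0n.
have mW i j : measurable_fun setT (fun w => window_matrix m g Z w i j).
  under eq_fun do rewrite mxE.
  by apply: measurable_funM => //; apply: measurable_sum.
have -> : n%:R * q ^+ 2 * e =
    \sum_(i < n) \sum_(j < n) (q / n%:R * \sum_(r < m.*2.+1) e).
  have sc k (c : R) : \sum_(i < k) c = k%:R * c.
    by rewrite sumr_const card_ord [RHS]mulr_natl.
  by rewrite !sc -/q; field.
have q0 : 0 <= q / n%:R by rewrite divr_ge0 // ler0n.
have H : mean_le P (fun w => \sum_(i < n) \sum_(j < n) (q / n%:R *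
    \sum_(r < m.*2.+1) Z (g i j + ((r : nat)%:Z - m%:Z)) w ^+ 2))
    (\sum_(i < n) \sum_(j < n) (q / n%:R * \sum_(r < m.*2.+1) e)).
  apply: (@mean_le_sum _ _ _ P _ _ _ (fun=> _)) => i.
  apply: (@mean_le_sum _ _ _ P _ _ _ (fun=> _)) => j; apply: mean_leZ => //.
  exact: (@mean_le_sum _ _ _ P _ _ _ (fun=> _)).
apply: mean_le_mono H.
  by apply: measurable_sum => i; apply: measurable_sum => j; exact: measurable_funX.
move=> w; apply/andP; split.
  by apply: sumr_ge0 => i _; apply: sumr_ge0 => j _; exact: sqr_ge0.
apply: ler_sum => i _; apply: ler_sum => j _.
rewrite mxE exprMn exprVn sqr_sqrtr ?ler0n // /window_sum.
rewrite [leRHS]mulrAC ler_pM2r ?invr_gt0 ?ltr0n //.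
exact: sqr_sum_le.
Qed.

(** Here [x] stands for the compression of the truncated noise and [y] for that of the remainder.
    The cost [|y|] is traded for [y ^+ 2], which the Frobenius norm controls after summation over
    the modes. *)
Lemma truncation_split (R : realType) (al t M ga x y : R) :
  0 <= al -> 0 <= t -> 0 < ga ->
  al * expR (t * x) <=
  Num.max (`|x + y| - M) 0 + ((2 * ga)^-1 * y ^+ 2 + ga / 2) +
  al * expR (t * (M + 1)) + al ^+ 2 / 4 * expR (2 * t * x).
Proof.
move=> al0 t0 ga0; apply: (le_trans (expR_truncate M x al0 t0)).
rewrite 2!lerD2r.
have amgm : `|y| <= (2 * ga)^-1 * y ^+ 2 + ga / 2.
  rewrite -(@real_normK _ y) ?num_real // -subr_ge0.
  have -> : (2 * ga)^-1 * `|y| ^+ 2 + ga / 2 - `|y| = (`|y| - ga) ^+ 2 / (2 * ga).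
    by field; rewrite gt_eqF.
  by rewrite divr_ge0 ?sqr_ge0 // mulr_ge0 // ltW.
apply: (@le_trans _ _ (Num.max (`|x + y| - M) 0 + `|y|)); last by rewrite lerD2l.
rewrite ge_max; apply/andP; split; last first.
  by rewrite addr_ge0 // le_max lexx orbT.
have h1 : `|x + y| - M <= Num.max (`|x + y| - M) 0 by rewrite le_max lexx.
have h2 : x <= `|x + y| + `|y|.
  by rewrite -{1}[x](addrK y) (le_trans (ler_norm _)) // ler_normB.
by lra.
Qed.

(** * The moment inequality at a fixed matrix size *)

Section Step.
Variables (R : realType) (d : measure_display) (T : measurableType d).
Variables (P : probability T R) (X : int -> {RV P >-> R}).
Hypothesis X_indep : mutually_independent X.
Hypothesis X_ident : identically_distributed X.
Variables (m n : nat) (c : 'I_n -> nat -> R) (b : 'I_n -> 'I_n) (G : nat -> int).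
Hypothesis n0 : (0 < n)%N.
Hypothesis c1 : forall k h, `|c k h| <= 1.
Hypothesis cc0 : forall h h', 0 <= \sum_k c k h * c k h'.
Hypothesis cc1 : forall h, n%:R / 2 <= \sum_k c k h * c k h.
Hypothesis G2 : forall p z, (#|[pred q : 'I_n | (G (p + b q) == z)%R]| <= 2)%N.
Hypothesis c_contr : forall A : 'M[R]_n,
  \sum_k compression c b A k ^+ 2 <= \sum_i \sum_j A i j ^+ 2.
Variables (V : finType) (kappa : R -> V) (mu x : V -> R) (B s2 eta : R).
Hypothesis kappa_meas : forall v, measurable (kappa @^-1` [set v]).
Hypothesis muE : forall v, P (X 0 @^-1` (kappa @^-1` [set v])) = (mu v)%:E.
Hypothesis mu0 : forall v, 0 <= mu v.
Hypothesis mu1 : \sum_v mu v = 1.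
Hypothesis mean0 : \sum_v x v * mu v = 0.
Hypothesis xB : forall v, `|x v| <= B.
Hypothesis s2E : s2 = \sum_v x v ^+ 2 * mu v.
Hypothesis X_sqr : forall i, mean_le P (fun w => X i w ^+ 2) 1.
Hypothesis X_err : forall i,
  mean_le P (fun w => (X i w - x (kappa (X i w))) ^+ 2) eta.
Variables (al t M K ga eps : R).
Hypotheses (al0 : 0 <= al) (t0 : 0 <= t) (ga0 : 0 < ga) (K0 : 0 < K).

Let g (p q : 'I_n) : int := G (p + b q)%N.
Let q : R := (m.*2.+1)%:R.
Hypothesis n_large : 2 * t * (2 * q / Num.sqrt n%:R) * B <= 1 / 2.

(* The part of the mean excess over [M] that is at most [K] times the proportion
   of eigenvalues outside [-M, M]; it is used because, unlike this proportion,
   it is clearly a measurable function. *)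
Definition compression_excess (w : T) : R :=
  Num.max (n%:R^-1 *
    (\sum_k Num.max (`|compression c b (window_matrix m g X w) k| - M) 0 -
     (\sum_i \sum_j window_matrix m g X w i j ^+ 2) / (4 * K))) 0.

Hypothesis excess_le : mean_le P compression_excess eps.

(** This is [truncation_split] averaged over the modes and integrated. The left side comes from the
    lower Laplace bound; on the right, the first two terms bound the excess of the full noise, the
    bracket pays for the remainder, and the last term is the upper Laplace bound at [2 * t]. *)
Lemma mean_compression_bound :
  al * expR (t ^+ 2 * s2 / 32) <=
  eps + q ^+ 2 / (4 * K) + (q ^+ 2 * eta / (2 * ga) + ga / 2) +
  al * expR (t * (M + 1)) + al ^+ 2 / 4 * expR (8 * t ^+ 2 * s2 * (2 * q ^+ 2)).
Proof.
pose s := coef_support m b G; pose a := coef m c b G.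
pose X' i w := x (kappa (X i w)).
pose X'' i w := X i w - X' i w.
pose D (Z : int -> T -> R) k w := compression c b (window_matrix m g Z w) k.
have DE Z k w : D Z k w = \sum_(i <- s) a k i * Z i w.
  exact: (compression_linear m c b G Z w k).
have mX i : measurable_fun setT (X i) by exact: measurable_funP.
have mX' i : measurable_fun setT (X' i).
  exact: (measurable_finite_factor x (mX i) kappa_meas).
have mX'' i : measurable_fun setT (X'' i) by exact: measurable_funB.
have mD Z k : (forall i, measurable_fun setT (Z i)) -> measurable_fun setT (D Z k).
  move=> mZ; rewrite (funext (DE Z k)).
  by apply: measurable_sum => i; apply: measurable_funM.
have DD k w : D (fun i => X i) k w = D X' k w + D X'' k w.
  rewrite !DE -big_split; apply: eq_bigr => i _ /=.
  by rewrite -mulrDr /X'' addrC subrK.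
have us : uniq s := coef_support_uniq m b G.
pose L u k := laplace_prod mu x s a u k.
have expD u k w : expR (u * D X' k w) =
    \prod_(i <- s) expR (u * (a k i * x (kappa (X i w)))).
  by rewrite DE mulr_sumr expR_sum.
have intL u k : (\int[P]_w (expR (u * D X' k w))%:E = (L u k)%:E)%E.
  under eq_integral do rewrite expD.
  rewrite (expectation_prod_indep X_indep X_ident kappa_meas muE
    (f := fun i v => expR (u * (a k i * x v)))) // => i v; exact: expR_ge0.
have mexp u k : measurable_fun setT (fun w => expR (u * D X' k w)).
  apply: measurableT_comp; first exact: measurable_expR.
  by apply: measurable_funM => //; exact: mD.
have mleL u k : mean_le P (fun w => expR (u * D X' k w)) (L u k).
  by split; [exact: mexp|move=> w; exact: expR_ge0|rewrite intL].
have B0 : 0 <= B by exact: le_trans (normr_ge0 _) (xB (kappa 0)).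
have aB k i : `|2 * t * a k i| * B <= 1 / 2.
  apply: le_trans n_large; rewrite ler_wpM2r // normrM ger0_norm ?mulr_ge0 //.
  by rewrite ler_wpM2l ?mulr_ge0 //; exact: coef_le.
have aC k : \sum_(i <- s) a k i ^+ 2 <= 2 * q ^+ 2.
  exact: sum_sqr_coef_le.
have aS : n%:R / 4 <= \sum_k \sum_(i <- s) a k i ^+ 2.
  exact: sum_sum_sqr_coef_ge.
have Lle := sum_laplace_prod_le mu0 mu1 mean0 xB aB aC.
have Lge := sum_laplace_prod_ge mu0 mu1 mean0 xB aB aS.
rewrite -s2E in Lle Lge.
pose Q (Z : int -> T -> R) w := \sum_i \sum_j window_matrix m g Z w i j ^+ 2.
have QX : mean_le P (Q (fun i => X i)) (n%:R * q ^+ 2 * 1).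
  exact: mean_le_window_matrix.
have QX'' : mean_le P (Q X'') (n%:R * q ^+ 2 * eta).
  exact: mean_le_window_matrix.
pose rhs w := n%:R * compression_excess w + (4 * K)^-1 * Q (fun i => X i) w +
  ((2 * ga)^-1 * Q X'' w + n%:R * (ga / 2)) + n%:R * (al * expR (t * (M + 1))) +
  al ^+ 2 / 4 * \sum_k expR (2 * t * D X' k w).
have rhs_le : mean_le P rhs (n%:R * eps + (4 * K)^-1 * (n%:R * q ^+ 2 * 1) +
  ((2 * ga)^-1 * (n%:R * q ^+ 2 * eta) + n%:R * (ga / 2)) +
  n%:R * (al * expR (t * (M + 1))) + al ^+ 2 / 4 * \sum_k L (2 * t) k).
  have c4 : 0 <= (4 * K)^-1 by rewrite invr_ge0 mulr_ge0 // ltW.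
  have c2 : 0 <= (2 * ga)^-1 by rewrite invr_ge0 mulr_ge0 // ltW.
  apply: mean_leD; last first.
    apply: mean_leZ; first by rewrite divr_ge0 ?sqr_ge0.
    by apply: mean_le_sum => k; exact: mleL.
  apply: mean_leD; last first.
    by apply: mean_le_cst; rewrite !mulr_ge0 ?ler0n ?expR_ge0.
  apply: mean_leD; first by apply: mean_leD; apply: mean_leZ => //; exact: ler0n.
  apply: mean_leD; first exact: mean_leZ.
  by apply: mean_le_cst; rewrite mulr_ge0 ?ler0n // divr_ge0 // ltW.
have n0' : 0 < n%:R :> R by rewrite ltr0n.
have sc (e : R) : \sum_(k < n) e = n%:R * e.
  by rewrite sumr_const card_ord [RHS]mulr_natl.
have pointwise w : al * \sum_k expR (t * D X' k w) <= rhs w.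
  rewrite mulr_sumr; apply: (le_trans (ler_sum _ (fun k _ =>
    truncation_split M (D X' k w) (D X'' k w) al0 t0 ga0))).
  rewrite !big_split /= !sc -!mulr_sumr /rhs.
  rewrite lerD2r lerD2r; apply: lerD.
    under eq_bigr do rewrite -DD.
    rewrite -lerBlDr.
    have : n%:R^-1 * (\sum_k Num.max (`|D (fun i => X i) k w| - M) 0 -
        Q (fun i => X i) w / (4 * K)) <= compression_excess w.
      by rewrite /compression_excess le_max lexx.
    by rewrite mulrC ler_pdivrMr // [(4 * K)^-1 * _]mulrC (mulrC n%:R).
  rewrite lerD2r; apply: ler_wpM2l; last exact: c_contr.
  by rewrite invr_ge0 mulr_ge0 // ltW.
have total : al * \sum_k L t k <= n%:R * eps + (4 * K)^-1 * (n%:R * q ^+ 2 * 1) +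
  ((2 * ga)^-1 * (n%:R * q ^+ 2 * eta) + n%:R * (ga / 2)) +
  n%:R * (al * expR (t * (M + 1))) + al ^+ 2 / 4 * \sum_k L (2 * t) k.
  have [mrhs rhs0] := rhs_le; rewrite -lee_fin; apply: le_trans.
  rewrite EFinM -sumEFin; under eq_bigr do rewrite -intL.
  rewrite -ge0_integral_sum //; last first.
    by move=> k; apply/measurable_EFinP; exact: mexp.
  under [in leLHS]eq_integral do rewrite sumEFin.
  have mS : measurable_fun setT (fun w => \sum_k expR (t * D X' k w)).
    by apply: measurable_sum => k; exact: mexp.
  have S0 w : 0 <= \sum_k expR (t * D X' k w).
    by apply: sumr_ge0 => k _; exact: expR_ge0.
  rewrite -ge0_integralZl //; last 2 first.
  - exact/measurable_EFinP.
  - by move=> w _; rewrite lee_fin.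
  apply: ge0_le_integral => //.
  - by move=> w _; rewrite -EFinM lee_fin mulr_ge0.
  - by apply: measurable_funeM; exact/measurable_EFinP.
  - exact/measurable_EFinP.
  - by move=> w _; rewrite -EFinM lee_fin.
rewrite -(ler_pM2l n0') mulrCA.
apply: (le_trans (ler_wpM2l al0 Lge)); apply: (le_trans total).
have q4 : 0 <= al ^+ 2 / 4 by rewrite divr_ge0 ?sqr_ge0.
rewrite [leRHS]mulrDr [X in _ <= _ + X]mulrCA.
apply: lerD; last by apply: ler_wpM2l.
by rewrite le_eqVlt; apply/orP; left; apply/eqP; field; rewrite !gt_eqF.
Qed.

End Step.

Lemma measurable_compression_excess (R : realType) (d : measure_display)
    (T : measurableType d) (P : probability T R) (X : int -> {RV P >-> R})
    (m n : nat) (c : 'I_n -> nat -> R) (b : 'I_n -> 'I_n) (G : nat -> int)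
    (M K : R) :
  measurable_fun setT (compression_excess X m c b G M K).
Proof.
have mW i j : measurable_fun setT (fun w =>
    window_matrix m (fun p q : 'I_n => G (p + b q)%N) X w i j).
  under eq_fun do rewrite mxE.
  apply: measurable_funM => //; apply: measurable_sum => r.
  exact: measurable_funP.
apply: measurable_maxr => //; apply: measurable_funM => //.
apply: measurable_funB.
  apply: measurable_sum => k; apply: measurable_maxr => //.
  apply: measurable_funB => //.
  apply: measurableT_comp => //; apply: measurable_funM => //.
  apply: measurable_sum => i; apply: measurable_sum => j.
  exact: measurable_funM.
apply: measurable_funM => //; apply: measurable_sum => i.
apply: measurable_sum => j; exact: measurable_funX.
Qed.

(** From [Y ^+ 2 <= 2 x ^+ 2 + 2 (Y - x) ^+ 2] and the same with [Y] and [x] exchanged, taken in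
    mean. *)
Lemma truncated_variance_bounds (R : realType) (d : measure_display)
    (T : measurableType d) (P : probability T R) (Y : {RV P >-> R})
    (V : finType) (kappa : R -> V) (mu x : V -> R) (eta : R) :
  (forall v, measurable (kappa @^-1` [set v])) ->
  (forall v, P (Y @^-1` (kappa @^-1` [set v])) = (mu v)%:E) ->
  (\int[P]_w ((Y w) ^+ 2)%:E = 1)%E ->
  mean_le P (fun w => (Y w - x (kappa (Y w))) ^+ 2) eta -> eta <= 1 / 4 ->
  1 / 4 <= \sum_v x v ^+ 2 * mu v <= 4.
Proof.
move=> mk muE Y2 err eta4; set s2 := \sum_v _.
have [_ s2E] := integral_finite_factor (fun v => x v ^+ 2) mk muE.
have mY : measurable_fun setT Y by exact: measurable_funP.
have mYx : measurable_fun setT (fun w => x (kappa (Y w))).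
  exact: (measurable_finite_factor x mY mk).
have Yle : mean_le P (fun w => Y w ^+ 2) 1.
  by split; [exact: measurable_funX|move=> w; exact: sqr_ge0|rewrite Y2].
have xle : mean_le P (fun w => x (kappa (Y w)) ^+ 2) s2.
  by split; [exact: measurable_funX|move=> w; exact: sqr_ge0|rewrite s2E].
have z2 : 0 <= 2 :> R by [].
have [_ _] : mean_le P (fun w => Y w ^+ 2) (2 * s2 + 2 * eta).
  apply: mean_le_mono (mean_leD (mean_leZ z2 xle) (mean_leZ z2 err)).
    exact: measurable_funX.
  move=> w; rewrite sqr_ge0 /= -subr_ge0.
  rewrite (_ : _ - _ = (Y w - 2 * x (kappa (Y w))) ^+ 2) ?sqr_ge0 //; ring.
have [_ _] : mean_le P (fun w => x (kappa (Y w)) ^+ 2) (2 * 1 + 2 * eta).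
  apply: mean_le_mono (mean_leD (mean_leZ z2 Yle) (mean_leZ z2 err)).
    exact: measurable_funX.
  move=> w; rewrite sqr_ge0 /= -subr_ge0.
  rewrite (_ : _ - _ = (2 * Y w - x (kappa (Y w))) ^+ 2) ?sqr_ge0 //; ring.
rewrite Y2 s2E -/s2 !lee_fin => h1 h2; apply/andP; split; lra.
Qed.

(* [t] makes [t ^+ 2 * s2 / 32] exceed [t * (M + 1)]; then [dl] is chosen to
   absorb the second exponential moment, with [al = 2 * dl], [K = q ^+ 2 / dl] and
   [ga = dl / 2]. *)
Lemma compression_constants (R : realType) (M q s2 eta : R) :
  0 <= M -> 1 <= q -> 1 / 4 <= s2 <= 4 ->
  let t := 128 * (M + 2) in
  let dl := expR (- (64 * t ^+ 2 * q ^+ 2)) in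
  eta <= dl ^+ 2 / (8 * q ^+ 2) ->
  ~ 2 * dl * expR (t ^+ 2 * s2 / 32) <=
    dl / 4 + q ^+ 2 / (4 * (q ^+ 2 / dl)) +
    (q ^+ 2 * eta / (2 * (dl / 2)) + (dl / 2) / 2) +
    2 * dl * expR (t * (M + 1)) +
    (2 * dl) ^+ 2 / 4 * expR (8 * t ^+ 2 * s2 * (2 * q ^+ 2)).
Proof.
move=> M0 q1 /andP[s1 s4] t dl etale.
have dl0 : 0 < dl by exact: expR_gt0.
have q0 : 0 < q by lra.
have q20 : 0 < q ^+ 2 by rewrite exprn_gt0.
have t1 : 1 <= t by rewrite /t; lra.
have t20 : 0 <= t ^+ 2 by exact: sqr_ge0.
(* As [s2 >= 1 / 4], the exponent is at least [t ^+ 2 / 128 = t * (M + 2)]; the extra 1 comes from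
   [expR t >= 1 + t]. *)
have e1 : expR (t * (M + 1)) + 1 <= expR (t ^+ 2 * s2 / 32).
  apply: (@le_trans _ _ (expR (t * (M + 2)))).
    rewrite (_ : t * (M + 2) = t * (M + 1) + t); last by ring.
    rewrite expRD.
    have h1 : 1 <= expR (t * (M + 1)).
      by rewrite -[leLHS]expR0 ler_expR mulr_ge0 //; lra.
    have h2 : 1 + t <= expR t by exact: expR_ge1Dx.
    apply: (@le_trans _ _ (expR (t * (M + 1)) * (1 + t))); last first.
      by rewrite ler_wpM2l // expR_ge0.
    rewrite [leRHS]mulrDr mulr1 lerD2l -[leLHS]mulr1 ler_pM //.
  rewrite ler_expR.
  have -> : t * (M + 2) = t ^+ 2 * (1 / 4) / 32 by rewrite /t; field.
  by rewrite ler_pM2r ?invr_gt0 // ler_wpM2l.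
(* [s2 <= 4] bounds the exponent by [64 * t ^+ 2 * q ^+ 2], which [dl] cancels. *)
have e2 : dl * expR (8 * t ^+ 2 * s2 * (2 * q ^+ 2)) <= 1.
  rewrite /dl -expRD -[leRHS]expR0 ler_expR.
  rewrite (_ : _ + _ = 16 * t ^+ 2 * q ^+ 2 * (s2 - 4)); last by ring.
  rewrite mulr_ge0_le0 ?subr_le0 //.
  by rewrite mulr_ge0 ?(ltW q20) // mulr_ge0.
have f1 : q ^+ 2 / (4 * (q ^+ 2 / dl)) = dl / 4.
  by field; rewrite !gt_eqF.
have f2 : q ^+ 2 * eta / (2 * (dl / 2)) <= dl / 8.
  rewrite (_ : 2 * (dl / 2) = dl); last by field.
  rewrite ler_pdivrMr // mulrC -ler_pdivlMr //.
  by rewrite (_ : _ / q ^+ 2 = dl ^+ 2 / (8 * q ^+ 2)) //; field; rewrite gt_eqF.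
have f3 : (2 * dl) ^+ 2 / 4 * expR (8 * t ^+ 2 * s2 * (2 * q ^+ 2)) <= dl.
  rewrite (_ : (2 * dl) ^+ 2 / 4 = dl * dl); last by field.
  by rewrite -mulrA ler_piMr // ltW.
have f4 : 2 * dl * (expR (t * (M + 1)) + 1) <= 2 * dl * expR (t ^+ 2 * s2 / 32).
  by rewrite ler_wpM2l // mulr_ge0 // ltW.
(* The error terms add up to at most [15 / 8 * dl], short of the gain [2 * dl] in [f4]. *)
rewrite f1 => H.
move: f4 H f2 f3; rewrite mulrDr mulr1.
move: (2 * dl * expR (t * (M + 1))) (2 * dl * expR _) => y z.
lra.
Qed.

(** * The contradiction for window matrices *)

Section Unbounded.
Variables (R : realType) (d : measure_display) (T : measurableType d).
Variables (P : probability T R) (X : int -> {RV P >-> R}).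
Hypothesis X_indep : mutually_independent X.
Hypothesis X_ident : identically_distributed X.
Hypothesis X_mean : forall k, ('E_P[X k] = 0)%E.
Hypothesis X_var : forall k, ('V_P[X k] = 1)%E.
Variables (m : nat) (b : forall n, 'I_n -> 'I_n) (G : nat -> nat -> int).
Hypothesis b_inj : forall n, injective (@b n).
Hypothesis G2 : forall n p z, (#|[pred q : 'I_n | (G n (p + b q) == z)%R]| <= 2)%N.

Variable A : forall n : nat, T -> 'M[R]_n.
Hypothesis AE : forall n w,
  A n w = window_matrix m (fun p q : 'I_n => G n (p + b q)%N) X w.
Hypothesis A_sym : forall n w, (A n w)^T = A n w.

Lemma window_lsd_unbounded (L : probability R R) :
  is_lsd P A L -> unbounded_support L.
Proof.
move=> lsd bnd; have [M [M0 aep]] := lsd_bounded_support lsd bnd.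
pose q : R := (m.*2.+1)%:R.
have q1 : 1 <= q by rewrite ler1n.
have q20 : 0 < q ^+ 2 by rewrite exprn_gt0 //; lra.
pose t := 128 * (M + 2); pose dl := expR (- (64 * t ^+ 2 * q ^+ 2)).
have t0 : 0 <= t by rewrite /t; lra.
have dl0 : 0 < dl by exact: expR_gt0.
(* The first bound serves the final choice of constants, the second keeps the truncated variance
   between [1 / 4] and 4. *)
pose eta := Num.min (dl ^+ 2 / (8 * q ^+ 2)) (1 / 4).
have eta0 : 0 < eta.
  by rewrite lt_min divr_gt0 ?exprn_gt0 ?mulr_gt0 //=; lra.
have etale : eta <= dl ^+ 2 / (8 * q ^+ 2) by rewrite ge_min lexx.
have eta4 : eta <= 1 / 4 by rewrite ge_min lexx orbT.
pose K := q ^+ 2 / dl; have K0 : 0 < K by rewrite divr_gt0.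
have X2 k := (integral_sqr_of_variance (X_mean k) (X_var k)).2.
have X1 k := (integral_sqr_of_variance (X_mean k) (X_var k)).1.
have [V [kappa [mu [x [mk muE mean0 err]]]]] :=
  finite_truncation (X2 0) (X1 0) eta0.
have [mu0 mu1] := finite_law_sum mk muE.
have mkR : measurable_fun setT (fun y : R => (y - x (kappa y)) ^+ 2).
  apply: measurable_funX; apply: measurable_funB => //.
  exact: (measurable_finite_factor x (@measurable_id _ R setT) mk).
have X_err i : mean_le P (fun w => (X i w - x (kappa (X i w))) ^+ 2) eta.
  split; [|by move=> w; exact: sqr_ge0|].
    by apply: (measurableT_comp mkR); exact: measurable_funP.
  rewrite (ident_ge0_integral (f := fun y => (y - x (kappa y)) ^+ 2) i 0
    X_ident mkR) //.
  by move=> y; exact: sqr_ge0.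
have X_sqr i : mean_le P (fun w => X i w ^+ 2) 1.
  split; [|by move=> w; exact: sqr_ge0|by rewrite X2].
  by apply: measurable_funX; exact: measurable_funP.
have s2b := truncated_variance_bounds mk muE (X2 0) (X_err 0) eta4.
pose B := \sum_v `|x v|.
have xB v : `|x v| <= B.
  by rewrite /B (bigD1 v) //= lerDl sumr_ge0.
(* Matrices of order [n.+1] are used, so that Fourier modes exist for every [n]. *)
pose c n := sval (cid (exists_compression R (ltn0Sn n))).
have cP n := svalP (cid (exists_compression R (ltn0Sn n))).
pose h n := compression_excess X m (c n) (@b n.+1) (G n.+1) M K.
pose p n w := 1 - esd (A n.+1 w) M + esd (A n.+1 w) (- M).
have p1 n w : p n w <= 1.
  have : esd (A n.+1 w) (- M) <= esd (A n.+1 w) M.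
    by apply: le_esd; rewrite (le_trans _ M0) // oppr_le0.
  by move=> le_pm; rewrite /p -addrA gerDl addrC subr_le0.
have p0 n w : 0 <= p n w.
  have h1 : esd (A n.+1 w) M <= 1 by exact: esd_le1.
  have h2 : 0 <= esd (A n.+1 w) (- M) by rewrite /esd divr_ge0 ?ler0n.
  by rewrite /p addr_ge0 // subr_ge0.
(* The spectral bound of [exists_compression] divided by the order: once the Frobenius term is
   subtracted, only the share [p n w] of eigenvalues outside []-M, M]] remains. *)
have hp n w : 0 <= h n w <= K * p n w.
  have Kp : 0 <= K * p n w by rewrite mulr_ge0 // ltW.
  rewrite /h /compression_excess le_max lexx orbT ge_max Kp andbT /=.
  have [_ _ _ /(_ _ (b_inj (n := n.+1)) (A n.+1 w))] := cP n.
  move=> [_ /(_ (A_sym n.+1 w) K M K0 M0) H].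
  rewrite ler_pdivrMl ?ltr0n // lerBlDr -AE; apply: (le_trans H).
  by rewrite lerD2r /p mulrCA.
have near1 : \forall n \near \oo, mean_le P (h n) (dl / 4).
  apply: (@mean_le_near _ _ _ _ h p K (dl / 4)) => //.
  - by rewrite divr_gt0.
  - by move=> n; exact: measurable_compression_excess.
  - by move=> n w; rewrite ler_piMr // ltW.
  by apply: filterS aep => w; rewrite -(cvg_shiftS (fun n => 1 - esd (A n w) M + _)).
(* Makes the coefficients small enough for the Laplace bounds at [2 * t]. *)
have near2 : \forall n \near \oo, (8 * t * q * B) ^+ 2 <= n%:R.
  exact: nbhs_infty_ger.
have [n [/= hn nn]] := filter_ex (filterI near1 near2).
have [c1 cc0 cc1 cb] := cP n.
apply: (compression_constants M0 q1 s2b etale); rewrite -/t -/dl -/K.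
have N0 : 0 < Num.sqrt n.+1%:R :> R by rewrite sqrtr_gt0 ltr0n.
have B0 : 0 <= B by rewrite sumr_ge0.
apply: (@mean_compression_bound _ _ _ P X X_indep X_ident m n.+1 (c n) (@b n.+1)
  (G n.+1) (ltn0Sn n) c1 cc0 cc1 (@G2 n.+1)
  (fun C => (cb _ (b_inj (n := n.+1)) C).1) V kappa mu x B _ eta mk muE mu0 mu1
  mean0 xB erefl X_sqr X_err) => //.
- by rewrite mulr_ge0 // ltW.
- by rewrite divr_gt0.
have nn' : 8 * t * q * B <= Num.sqrt n.+1%:R.
  have H8 : 0 <= 8 * t * q * B.
    by rewrite (mulr_ge0 (mulr_ge0 (mulr_ge0 _ t0) (le_trans ler01 q1)) B0).
  rewrite -[leLHS](ger0_norm H8) -sqrtr_sqr ler_wsqrtr // (le_trans nn) // ler_nat.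
  exact: leqnSn.
rewrite (_ : 2 * t * _ * B = (8 * t * q * B) / Num.sqrt n.+1%:R / 2); last first.
  by field; rewrite gt_eqF.
by rewrite ler_pM2r ?invr_gt0 // ler_pdivrMr // mul1r.
Qed.

End Unbounded.

(** * Toeplitz and Hankel matrices *)

Lemma card_le_image (n : nat) (A : pred 'I_n) (s : seq int) :
  (forall q : 'I_n, A q -> (q : nat)%:Z \in s) -> (#|A| <= size s)%N.
Proof.
move=> As; rewrite cardE -(size_map (fun q : 'I_n => (q : nat)%:Z)).
apply: uniq_leq_size.
  by rewrite map_inj_uniq ?enum_uniq // => p q [] /ord_inj.
by move=> _ /mapP[q +->]; rewrite mem_enum => /As.
Qed.

(* [p + rev_ord q - (n - 1) = p - q] *)
Lemma toeplitz_window (R : realType) (T : Type) (X : int -> T -> R) (m n : nat)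
    (w : T) :
  toeplitz X m n w = window_matrix m
    (fun p q : 'I_n => `|(p + rev_ord q)%N%:Z - n.-1%:Z|) X w.
Proof.
apply/matrixP => p q; rewrite !mxE; congr (window_sum _ _ _ _ / _).
by congr `|_|; case: n p q => [[]//|n] p q /=; have := ltn_ord q; lia.
Qed.

Lemma hankel_window (R : realType) (T : Type) (X : int -> T -> R) (m n : nat)
    (w : T) :
  hankel X m n w = window_matrix m
    (fun p q : 'I_n => n%:Z - 1 - (p + q)%N%:Z) X w.
Proof.
apply/matrixP => p q; rewrite !mxE; congr (window_sum _ _ _ _ / _).
lia.
Qed.

Theorem theorem4 (R : realType) (d : measure_display) (T : measurableType d)
    (P : probability T R) (X : int -> {RV P >-> R})
    (X_indep : mutually_independent X)
    (X_ident : identically_distributed X)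
    (X_mean : forall k : int, ('E_P[X k] = 0)%E)
    (X_var : forall k : int, ('V_P[X k] = 1)%E)
    (m : nat) (L_T L_H : probability R R) :
  (is_lsd P (toeplitz X m) L_T -> unbounded_support L_T) /\
  (is_lsd P (hankel X m) L_H -> unbounded_support L_H).
Proof.
split.
  apply: (window_lsd_unbounded X_indep X_ident X_mean X_var (b := @rev_ord)
    (G := fun n h => `|h%:Z - n.-1%:Z|) _ _ (toeplitz_window X m)).
  - by move=> n; exact: rev_ord_inj.
  (* [|p - q| = z] leaves the candidates [q = p - z] and [q = p + z], whence the bound 2 in [G2]. *)
  - move=> n p z; rewrite -[2%N]/(size [:: p%:Z - z; p%:Z + z]).
    apply: card_le_image => q; rewrite !inE.
    by case: n q => [[]//|n] q /=; have := ltn_ord q; lia.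
  - by move=> n w; apply/matrixP => i j; rewrite !mxE distrC.
apply: (window_lsd_unbounded X_indep X_ident X_mean X_var (b := fun n => id)
  (G := fun n h => n%:Z - 1 - h%:Z) _ _ (hankel_window X m)).
- by move=> n; exact: inj_id.
(* The sum [p + q] is prescribed, so at most one [q] is left. *)
- move=> n p z; apply: (@leq_trans 1%N) => //.
  rewrite -[1%N]/(size [:: n%:Z - 1 - p%:Z - z]).
  by apply: card_le_image => q; rewrite !inE; lia.
- by move=> n w; apply/matrixP => i j; rewrite !mxE [(i.+1)%:Z + _]addrC.
Qed.
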